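(* There exists a sequence $F=\{F_n\}_{n\in\mathbb{Z}}$ with $F_n\in\mathbb{D}$ for all $n$ and $F\in\ell^2(\mathbb{Z})$ such that, for every $z\in\mathbb{T}$, neither of the limits $\lim_{N\to\infty}\mathfrak{a}(z,F^{\langle N\rangle})$ and $\lim_{N\to\infty}\mathfrak{b}(z,F^{\langle N\rangle})$ exists.
   Context: $\mathbb{T}$ and $\mathbb{D}$ denote the unit circle and the open unit disc in $\mathbb{C}$. For a sequence $F=\{F_n\}_{n\in\mathbb{Z}}$ with $F_n\in\mathbb{D}$ and $N\in\mathbb{Z}^+$, the truncation is $F^{\langle N\rangle}_n=F_n\chi_{|n|\leqslant N}$. For a finitely supported sequence $G$ with values in $\mathbb{D}$ (the $SU(1,1)$ nonlinear Fourier transform on $\mathbb{Z}$): define $2\times2$ matrices $\widetilde X_n(z)$ by $\widetilde X_n=I$ for all $n$ below the support of $G$ and $\widetilde X_n=(1-|G_n|^2)^{-1/2}\begin{pmatrix}1&\overline{G_n}z^{-n}\\ G_nz^n&1\end{pmatrix}\widetilde X_{n-1}$. For $n$ above the support, $\widetilde X_n$ is constant and has the form $\begin{pmatrix}\mathfrak{a}(z,G)&\mathfrak{b}^{( * )}(z,G)\\ \mathfrak{b}(z,G)&\mathfrak{a}^{( * )}(z,G)\end{pmatrix}$, where $f^{( * )}(z):=\overline{f(\bar z^{-1})}$; this defines $\mathfrak{a}(z,G)$ and $\mathfrak{b}(z,G)$. *)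

(* Defs.v *)
From Stdlib Require Import Reals ZArith.
From Coquelicot Require Import Coquelicot.
Open Scope R_scope.

Fixpoint Cpow_nat (z : C) (n : nat) : C :=
  match n with O => RtoC 1 | S k => Cmult z (Cpow_nat z k) end.

Definition Cpow_Z (z : C) (n : Z) : C :=
  match n with
  | Z0 => RtoC 1
  | Zpos p => Cpow_nat z (Pos.to_nat p)
  | Zneg p => Cpow_nat (Cinv z) (Pos.to_nat p)
  end.

Record mat2 := Mat2 { m11 : C; m12 : C; m21 : C; m22 : C }.

Definition mat2_mul (A B : mat2) : mat2 :=
  Mat2 (Cplus (Cmult (m11 A) (m11 B)) (Cmult (m12 A) (m21 B)))
       (Cplus (Cmult (m11 A) (m12 B)) (Cmult (m12 A) (m22 B)))
       (Cplus (Cmult (m21 A) (m11 B)) (Cmult (m22 A) (m21 B)))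
       (Cplus (Cmult (m21 A) (m12 B)) (Cmult (m22 A) (m22 B))).

Definition su11_factor (G : Z -> C) (z : C) (n : Z) : mat2 :=
  let c := RtoC (/ sqrt (1 - (Cmod (G n))^2)) in
  Mat2 c (Cmult c (Cmult (Cconj (G n)) (Cpow_Z z (- n))))
       (Cmult c (Cmult (G n) (Cpow_Z z n))) c.

Fixpoint nlft_window (G : Z -> C) (z : C) (lo : Z) (k : nat) : mat2 :=
  match k with
  | O => su11_factor G z lo
  | S j => mat2_mul (su11_factor G z (lo + Z.of_nat (S j))) (nlft_window G z lo j)
  end.

Definition trunc (F : Z -> C) (N : nat) : Z -> C :=
  fun n => if Z.leb (Z.abs n) (Z.of_nat N) then F n else RtoC 0.

(* The NLFT of the finitely supported F^<N> (support within [-N, N]):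
   the product of all factors from -N to N; factors outside are the identity. *)
Definition nlft_trunc (F : Z -> C) (N : nat) (z : C) : mat2 :=
  nlft_window (trunc F N) z (- Z.of_nat N) (2 * N).

Definition frak_a (F : Z -> C) (N : nat) (z : C) : C := m11 (nlft_trunc F N z).
Definition frak_b (F : Z -> C) (N : nat) (z : C) : C := m21 (nlft_trunc F N z).

Definition ell2_Z (F : Z -> C) : Prop :=
  ex_series (fun n : nat => (Cmod (F (Z.of_nat n)))^2) /\
  ex_series (fun n : nat => (Cmod (F (- Z.of_nat n)%Z))^2).

Definition seq_has_limit (u : nat -> C) : Prop :=
  exists l : C, filterlim u eventually (locally l).

(* Main.v *)
Require Import Defs.
From Stdlib Require Import Reals ZArith Lra Lia.
From Coquelicot Require Import Coquelicot.
Open Scope R_scope.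

(** The second order term of [frak_a], the sum of [F_j conj(F_k) z^(j-k)] over
    [j < k], has as imaginary part the area swept by the partial Fourier sums of
    [F]. For a chirp of [l^2] norm [eps] the partial sums stay of size [eps],
    while just before the stationary point of [z] the swept area reaches
    [eps^2 log L]: the contribution of the frequencies at distance [d / L] from
    that of [z] is about [eps^2 / d].

    A stage is a discretised chirp: blocks of length [L], each carrying one
    frequency [j / L] and a parabolic weight. The weight vanishes at both ends,
    so the off-diagonal entry of a block at distance [d / L] is only
    [O(eps / d^2)], hence summable over the blocks and of total size [O(eps)],
    whereas the diagonal entry is [1 - i A] with [A] about [eps^2 / d], up to
    errors that are again summable. With [eps_k = 2^-k / 10^6] and
    [log L_k >= 120 / eps_k^2] the orbit stays bounded and bounded away from 0,
    but each stage whose frequencies surround that of [z] rotates both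
    [frak_a] and [frak_b] by a total angle at least 1 with error tending to 0. *)

(** * Finite sums and concatenation of blocks *)

Fixpoint rsum (f : nat -> R) (n : nat) : R :=
  match n with O => 0 | S k => rsum f k + f k end.

Lemma rsum_S (f : nat -> R) (n : nat) : rsum f (S n) = rsum f n + f n.
Proof. reflexivity. Qed.

Lemma rsum_ext (f g : nat -> R) (n : nat) :
  (forall i, (i < n)%nat -> f i = g i) -> rsum f n = rsum g n.
Proof.
  induction n as [|n IH]; intros H; simpl; auto.
  rewrite IH, (H n); auto with arith.
Qed.

Lemma rsum_le (f g : nat -> R) (n : nat) :
  (forall i, (i < n)%nat -> f i <= g i) -> rsum f n <= rsum g n.
Proof.
  induction n as [|n IH]; intros H; simpl; [lra|].
  apply Rplus_le_compat; auto with arith.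
Qed.

Lemma rsum_const (c : R) (n : nat) : rsum (fun _ => c) n = INR n * c.
Proof. induction n as [|n IH]; [simpl; ring|rewrite S_INR; simpl; rewrite IH; ring]. Qed.

Lemma rsum_scal (c : R) (f : nat -> R) (n : nat) :
  rsum (fun i => c * f i) n = c * rsum f n.
Proof. induction n as [|n IH]; simpl; [ring|rewrite IH; ring]. Qed.

Lemma rsum_plus (f g : nat -> R) (n : nat) :
  rsum (fun i => f i + g i) n = rsum f n + rsum g n.
Proof. induction n as [|n IH]; simpl; [ring|rewrite IH; ring]. Qed.

Lemma rsum_split (f : nat -> R) (m n : nat) :
  rsum f (m + n) = rsum f m + rsum (fun i => f (m + i)%nat) n.
Proof.
  induction n as [|n IH]; [rewrite Nat.add_0_r; simpl; ring|].
  rewrite Nat.add_succ_r; simpl; rewrite IH; ring.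
Qed.

Lemma rsum_ge_0 (f : nat -> R) (n : nat) : (forall i, 0 <= f i) -> 0 <= rsum f n.
Proof. intros H; induction n as [|n IH]; simpl; [lra|specialize (H n); lra]. Qed.

Lemma rsum_mono (f : nat -> R) (m n : nat) :
  (forall i, 0 <= f i) -> (m <= n)%nat -> rsum f m <= rsum f n.
Proof.
  intros H Hmn. replace n with (m + (n - m))%nat by lia. rewrite rsum_split.
  pose proof (rsum_ge_0 (fun i => f (m + i)%nat) (n - m) (fun i => H _)). lra.
Qed.

Lemma rsum_geom_half (n : nat) : rsum (fun k => (/ 2) ^ k) n <= 2.
Proof.
  assert (E : rsum (fun k => (/ 2) ^ k) n = 2 - 2 * (/ 2) ^ n).
  { induction n as [|n IH]; simpl; [ring|rewrite IH; field]. }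
  rewrite E. assert (0 < (/ 2) ^ n) by (apply pow_lt; lra). lra.
Qed.

Lemma ex_series_of_rsum_bound (f : nat -> R) (M : R) :
  (forall i, 0 <= f i) -> (forall n, rsum f n <= M) -> ex_series f.
Proof.
  intros H0 HM.
  assert (E : forall n, sum_n f n = rsum f (S n)).
  { induction n as [|n IH].
    - rewrite sum_O; simpl; ring.
    - rewrite sum_Sn, IH; reflexivity. }
  destruct (ex_finite_lim_seq_incr (sum_n f) M) as [l Hl].
  - intros n. rewrite !E. apply rsum_mono; auto.
  - intros n. rewrite E. apply HM.
  - exists l. exact Hl.
Qed.

(* [blk len n] is the pair (block, offset) of position [n] when blocks of
   lengths [len 0, len 1, ...] are laid end to end. *)
Fixpoint blk (len : nat -> nat) (n : nat) : nat * nat :=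
  match n with
  | O => (O, O)
  | S m => let (k, i) := blk len m in
           if Nat.ltb (S i) (len k) then (k, S i) else (S k, O)
  end.

Fixpoint start (len : nat -> nat) (k : nat) : nat :=
  match k with O => O | S m => (start len m + len m)%nat end.

Lemma blk_start (len : nat -> nat) (len_pos : forall k, (0 < len k)%nat)
  (k i : nat) : (i < len k)%nat -> blk len (start len k + i) = (k, i).
Proof.
  assert (H : forall k, blk len (start len k) = (k, O) ->
     forall i, (i < len k)%nat -> blk len (start len k + i) = (k, i)).
  { intros m Hm j; induction j as [|j IH]; intros Hj.
    - now rewrite Nat.add_0_r.
    - rewrite Nat.add_succ_r; simpl. rewrite IH by lia.
      assert (E : Nat.ltb (S j) (len m) = true) by (apply Nat.ltb_lt; lia).
      now rewrite E. }
  revert i. induction k as [|k IH]; intros i Hi.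
  - apply H; auto.
  - apply H; auto. simpl. specialize (len_pos k).
    (* The first position of a block is the successor of the last position of the block before it,
       where the test in [blk] fails. *)
    specialize (IH (len k - 1)%nat ltac:(lia)).
    replace (start len k + len k)%nat with (S (start len k + (len k - 1)))%nat by lia.
    simpl. rewrite IH.
    assert (E : Nat.ltb (S (len k - 1)) (len k) = false) by (apply Nat.ltb_ge; lia).
    now rewrite E.
Qed.

Lemma start_ge (len : nat -> nat) (len_pos : forall k, (0 < len k)%nat)
  (k : nat) : (k <= start len k)%nat.
Proof. induction k as [|k IH]; simpl; [lia|specialize (len_pos k); lia]. Qed.

Lemma blk_lt (len : nat -> nat) (len_pos : forall k, (0 < len k)%nat)
  (n : nat) : (snd (blk len n) < len (fst (blk len n)))%nat.
Proof.
  induction n as [|n IH]; simpl; [apply len_pos|].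
  destruct (blk len n) as [k i].
  destruct (Nat.ltb (S i) (len k)) eqn:E; simpl; auto.
  now apply Nat.ltb_lt.
Qed.

Lemma rsum_blk_le (len : nat -> nat) (len_pos : forall k, (0 < len k)%nat)
  (f : nat * nat -> R) (c : nat -> R) (M : R) :
  (forall p, 0 <= f p) ->
  (forall k, rsum (fun i => f (k, i)) (len k) <= c k) ->
  (forall k, rsum c k <= M) ->
  forall n, rsum (fun n => f (blk len n)) n <= M.
Proof.
  intros Hf Hc HM n.
  (* Since [f] is nonnegative and [n <= start len n], the sum may be extended to the end of a whole
     block. *)
  apply Rle_trans with (rsum (fun n => f (blk len n)) (start len n)).
  { apply rsum_mono; auto. now apply start_ge. }
  apply Rle_trans with (rsum c n); auto.
  induction n as [|n IH]; simpl; [lra|].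
  rewrite rsum_split. apply Rplus_le_compat; auto.
  eapply Rle_trans; [|apply Hc]. right. apply rsum_ext.
  intros i Hi. now rewrite blk_start.
Qed.

(** * Complex preliminaries *)

Definition cis (t : R) : C := (cos t, sin t).

Lemma Cmod_cis (t : R) : Cmod (cis t) = 1.
Proof.
  unfold Cmod, cis; simpl fst; simpl snd.
  replace (cos t ^ 2 + sin t ^ 2) with 1; [apply sqrt_1|].
  pose proof (sin2_cos2 t) as H; unfold Rsqr in H; lra.
Qed.

Lemma cis_plus (s t : R) : cis (s + t) = (cis s * cis t)%C.
Proof.
  unfold cis, Cmult; simpl. rewrite cos_plus, sin_plus. f_equal; ring.
Qed.

Lemma cis_period_nat (t : R) (p : nat) : cis (t + 2 * INR p * PI) = cis t.
Proof. unfold cis. now rewrite cos_period, sin_period. Qed.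

(** On the unit circle this is the principal argument, in [(-PI, PI]]. *)
Definition carg (z : C) : R :=
  if Rle_dec 0 (snd z) then acos (fst z) else - acos (fst z).

Lemma cis_carg (z : C) : Cmod z = 1 -> cis (carg z) = z.
Proof.
  intros Hz.
  assert (H : fst z ^ 2 + snd z ^ 2 = 1).
  { pose proof (Cmod2_alt z) as H. rewrite Hz in H. unfold Re, Im in H. lra. }
  assert (Hx : -1 <= fst z <= 1) by (split; nra).
  pose proof (cos_acos _ Hx) as Hc. pose proof (sin_acos _ Hx) as Hs.
  replace (1 - (fst z)²) with (Rsqr (snd z)) in Hs by (unfold Rsqr; lra).
  rewrite sqrt_Rsqr_abs in Hs.
  unfold carg, cis. destruct z as [x y]; simpl in *.
  destruct (Rle_dec 0 y) as [Hy|Hy].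
  - rewrite Hc, Hs, Rabs_pos_eq; auto.
  - rewrite cos_neg, sin_neg, Hc, Hs, Rabs_left by lra. f_equal; ring.
Qed.

Lemma carg_bound (z : C) : -4 <= carg z <= 4.
Proof.
  pose proof (acos_bound (fst z)). pose proof PI_4.
  unfold carg. destruct (Rle_dec 0 (snd z)); lra.
Qed.

Lemma carg_cis (t : R) : 0 <= t <= PI -> carg (cis t) = t.
Proof.
  intros Ht. unfold carg, cis; simpl.
  destruct (Rle_dec 0 (sin t)) as [_|H].
  - now apply acos_cos.
  - exfalso. apply H. apply sin_ge_0; lra.
Qed.

Lemma Cmod_triangle_minus (x y : C) : Cmod (x - y)%C <= Cmod x + Cmod y.
Proof. unfold Cminus. rewrite <- (Cmod_opp y). apply Cmod_triangle. Qed.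

Lemma Cmod_triangle_rev (x y : C) : Cmod x - Cmod y <= Cmod (x + y)%C.
Proof.
  pose proof (Cmod_triangle_minus (x + y) y) as H.
  replace (x + y - y)%C with x in H by ring. lra.
Qed.

Lemma Cmod_scal (r : R) (x : C) : 0 <= r -> Cmod (RtoC r * x)%C = r * Cmod x.
Proof. intros Hr. now rewrite Cmod_mult, Cmod_R, Rabs_pos_eq. Qed.

Lemma unit_mul_conj (z : C) : Cmod z = 1 -> (z * Cconj z)%C = 1.
Proof. intros H. rewrite <- Cmod2_conj, H. f_equal; ring. Qed.

Lemma seq_limit_Cmod (u : nat -> C) (l : C) :
  filterlim u eventually (locally l) ->
  forall eta, 0 < eta -> exists N, forall n, (N <= n)%nat -> Cmod (u n - l)%C < eta.
Proof.
  intros H eta Heta.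
  (* Balls of [C] are products of balls of the coordinates; two coordinates within [eta / 2] give
     modulus below [eta]. *)
  assert (He : 0 < eta / 2) by lra.
  destruct (proj1 (filterlim_locally u l) H (mkposreal _ He)) as [N HN].
  exists N. intros n Hn. specialize (HN n Hn).
  destruct HN as [H1 H2]; cbv [ball] in H1, H2; simpl in H1, H2.
  unfold AbsRing_ball, abs, minus, plus, opp in H1, H2; simpl in H1, H2.
  destruct (u n) as [x y], l as [x' y']; simpl in *.
  unfold Cmod; simpl.
  rewrite <- (sqrt_Rsqr eta) by lra. apply sqrt_lt_1_alt.
  apply Rabs_def2 in H1; apply Rabs_def2 in H2.
  set (p := x + - x') in *. set (q := y + - y') in *. unfold Rsqr.
  assert (p * p < eta / 2 * eta) by nra. assert (q * q < eta / 2 * eta) by nra.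
  split; nra.
Qed.

(** * Divergence from accumulated rotation *)

(** Near a limit [l] the increments over a window add up to [om * SA * l], where [SA >= 1] is the
    total rotation. Convergence makes this sum small relative to [SA], whereas [l] inherits the
    lower bound on the orbit. *)
Lemma no_limit_of_rotation (c : nat -> C) (om : C) (A E : nat -> R) (kappa : R) :
  Cmod om = 1 -> 0 < kappa -> (forall q, kappa <= Cmod (c q)) ->
  (forall q, Cmod (c (S q) - c q - om * RtoC (A q) * c q)%C <= E q) ->
  (forall eta N, 0 < eta -> exists q n, (N <= q)%nat /\
     (forall i, (i < n)%nat -> 0 <= A (q + i)%nat) /\
     1 <= rsum (fun i => A (q + i)%nat) n /\
     rsum (fun i => E (q + i)%nat) n <= eta) ->
  forall l, ~ (forall eta, 0 < eta ->
     exists N, forall n, (N <= n)%nat -> Cmod (c n - l)%C < eta).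
Proof.
  intros Hom Hk Hc Hstep Hwin l Hl.
  (* With this choice [Cmod l >= 9 * eta], while the window gives [SA * Cmod l <= (3 + SA) * eta],
     impossible for [SA >= 1]. *)
  set (eta := kappa / 10). assert (He : 0 < eta) by (unfold eta; lra).
  destruct (Hl eta He) as [N HN].
  destruct (Hwin eta N He) as (q & n & Hq & HA & HA1 & HE).
  (* Replacing the current value of [c] by [l] costs [eta] per unit of rotation. *)
  assert (Hw : forall m, (m <= n)%nat ->
    0 <= rsum (fun i => A (q + i)%nat) m /\
    Cmod (c (q + m)%nat - c q - om * RtoC (rsum (fun i => A (q + i)%nat) m) * l)%C
    <= eta * rsum (fun i => A (q + i)%nat) m + rsum (fun i => E (q + i)%nat) m).
  { induction m as [|m IH]; intros Hm.
    - simpl. rewrite Nat.add_0_r. split; [lra|].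
      replace (c q - c q - om * 0 * l)%C with (RtoC 0) by ring. rewrite Cmod_0; lra.
    - destruct (IH ltac:(lia)) as [IH0 IH1]. simpl rsum.
      pose proof (HA m ltac:(lia)) as HAm. split; [lra|].
      rewrite Nat.add_succ_r. pose proof (Hstep (q + m)%nat) as Hs.
      set (SA := rsum (fun i => A (q + i)%nat) m) in *.
      set (Am := A (q + m)%nat) in *.
      replace (c (S (q + m)) - c q - om * RtoC (SA + Am) * l)%C with
        ((c (q + m)%nat - c q - om * RtoC SA * l) +
         ((c (S (q + m)) - c (q + m)%nat - om * RtoC Am * c (q + m)%nat) +
          om * (RtoC Am * (c (q + m)%nat - l))))%C
        by (rewrite RtoC_plus; ring).
      eapply Rle_trans; [apply Cmod_triangle|].
      eapply Rle_trans; [apply Rplus_le_compat_l, Cmod_triangle|].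
      rewrite (Cmod_mult om), Hom, Cmod_scal by auto.
      pose proof (HN (q + m)%nat ltac:(lia)). nra. }
  destruct (Hw n (le_n n)) as [_ H1].
  set (SA := rsum (fun i => A (q + i)%nat) n) in *.
  pose proof (HN q Hq) as H2. pose proof (HN (q + n)%nat ltac:(lia)) as H3.
  assert (H4 : SA * Cmod l <= 2 * eta + eta * SA + eta).
  { replace (SA * Cmod l) with (Cmod (om * (RtoC SA * l))%C)
      by (rewrite Cmod_mult, Hom, Cmod_scal; lra).
    replace (om * (RtoC SA * l))%C with
      ((c (q + n)%nat - l) - (c q - l) - (c (q + n)%nat - c q - om * RtoC SA * l))%C by ring.
    eapply Rle_trans; [apply Cmod_triangle_minus|].
    pose proof (Cmod_triangle_minus (c (q + n)%nat - l) (c q - l)). lra. }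
  assert (H5 : kappa - eta <= Cmod l).
  { pose proof (Cmod_triangle_minus (c q) (c q - l)) as H.
    replace (c q - (c q - l))%C with l in H by ring.
    pose proof (Cmod_triangle l (c q - l)) as H'.
    replace (l + (c q - l))%C with (c q) in H' by ring.
    pose proof (Hc q). lra. }
  unfold eta in *. nra.
Qed.

(** The determinant condition puts [Cmod (al q)] between 1 and [1 + Cmod (be q)], so the moduli of
    [a] and [b] can only drift through the summable off-diagonal entries, however much the diagonal
    rotates. *)
Lemma su11_orbit_bounds (al be a b : nat -> C) :
  (forall q, a (S q) = (al q * a q + Cconj (be q) * b q)%C) ->
  (forall q, b (S q) = (be q * a q + Cconj (al q) * b q)%C) ->
  (forall q, Cmod (al q) ^ 2 = 1 + Cmod (be q) ^ 2) ->
  (forall n, rsum (fun q => Cmod (be q)) n <= / 32) ->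
  Cmod (a O) + Cmod (b O) <= 2 -> / 2 <= Cmod (a O) -> / 2 <= Cmod (b O) ->
  forall q, Cmod (a q) + Cmod (b q) <= 3 /\ / 4 <= Cmod (a q) /\ / 4 <= Cmod (b q).
Proof.
  intros Ha Hb Hdet Hsum H0 Ha0 Hb0.
  set (s := rsum (fun q => Cmod (be q))) in *.
  (* While the sum of the moduli is at most 3, one step adds at most [6 * Cmod (be q)] to it and
     takes at most [3 * Cmod (be q)] from each modulus. As [s <= 1/32], the bounds 3 and 1/4 are
     never crossed. *)
  assert (H : forall q, Cmod (a q) + Cmod (b q) <= 2 + 6 * s q /\
    / 2 - 3 * s q <= Cmod (a q) /\ / 2 - 3 * s q <= Cmod (b q)).
  { induction q as [|q (IH1 & IH2 & IH3)].
    - unfold s; simpl; lra.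
    - pose proof (Hsum q) as Hsq. pose proof (Hdet q) as Hd.
      assert (Es : s (S q) = s q + Cmod (be q)) by reflexivity. rewrite Es. clear Es.
      pose proof (Cmod_ge_0 (al q)). pose proof (Cmod_ge_0 (be q)).
      pose proof (Cmod_ge_0 (a q)). pose proof (Cmod_ge_0 (b q)).
      assert (Hal1 : 1 <= Cmod (al q)) by nra.
      assert (Hal2 : Cmod (al q) <= 1 + Cmod (be q)) by nra.
      pose proof (Cmod_triangle (al q * a q) (Cconj (be q) * b q)) as T1.
      pose proof (Cmod_triangle_rev (al q * a q) (Cconj (be q) * b q)) as T2.
      pose proof (Cmod_triangle (be q * a q) (Cconj (al q) * b q)) as T3.
      pose proof (Cmod_triangle_rev (Cconj (al q) * b q) (be q * a q)) as T4.
      rewrite (Cplus_comm (Cconj (al q) * b q)) in T4.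
      rewrite <- Ha in T1, T2. rewrite <- Hb in T3, T4.
      rewrite !Cmod_mult, !Cmod_conj in *.
      assert (Cmod (a q) + Cmod (b q) <= 3) by lra.
      assert (Cmod (al q) * Cmod (a q) >= Cmod (a q)) by nra.
      assert (Cmod (al q) * Cmod (b q) >= Cmod (b q)) by nra.
      assert (Cmod (be q) * Cmod (a q) <= Cmod (be q) * 3) by nra.
      assert (Cmod (be q) * Cmod (b q) <= Cmod (be q) * 3) by nra.
      repeat split; nra. }
  intros q. specialize (H q). specialize (Hsum q). lra.
Qed.

(* A window only has to show total rotation at least 1 with a small total
   error; no bound on the rotation from above is needed. *)
Lemma su11_orbit_diverges (al be a b : nat -> C) (A e : nat -> R) :
  (forall q, a (S q) = (al q * a q + Cconj (be q) * b q)%C) ->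
  (forall q, b (S q) = (be q * a q + Cconj (al q) * b q)%C) ->
  (forall q, Cmod (al q) ^ 2 = 1 + Cmod (be q) ^ 2) ->
  (forall n, rsum (fun q => Cmod (be q)) n <= / 32) ->
  Cmod (a O) + Cmod (b O) <= 2 -> / 2 <= Cmod (a O) -> / 2 <= Cmod (b O) ->
  (forall q, Cmod (al q - 1 + Ci * RtoC (A q))%C <= e q) ->
  (forall eta N, 0 < eta -> exists q n, (N <= q)%nat /\
     (forall i, (i < n)%nat -> 0 <= A (q + i)%nat) /\
     1 <= rsum (fun i => A (q + i)%nat) n /\
     rsum (fun i => e (q + i)%nat + Cmod (be (q + i)%nat)) n <= eta) ->
  forall l,
  ~ (forall eta, 0 < eta -> exists N, forall n, (N <= n)%nat -> Cmod (a n - l)%C < eta) /\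
  ~ (forall eta, 0 < eta -> exists N, forall n, (N <= n)%nat -> Cmod (b n - l)%C < eta).
Proof.
  intros Ha Hb Hdet Hsum H0 Ha0 Hb0 He Hwin l.
  pose proof (su11_orbit_bounds al be a b Ha Hb Hdet Hsum H0 Ha0 Hb0) as Hbd.
  assert (Hwin' : forall eta N, 0 < eta -> exists q n, (N <= q)%nat /\
     (forall i, (i < n)%nat -> 0 <= A (q + i)%nat) /\
     1 <= rsum (fun i => A (q + i)%nat) n /\
     rsum (fun i => 3 * (e (q + i)%nat + Cmod (be (q + i)%nat))) n <= eta).
  { intros eta N Heta. destruct (Hwin (eta / 3) N ltac:(lra)) as (q & n & H1 & H2 & H3 & H4).
    exists q, n. repeat split; auto.
    rewrite (rsum_scal 3 (fun i => e (q + i)%nat + Cmod (be (q + i)%nat))). lra. }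
  assert (E : forall x y u v : C, Cmod x <= 3 -> Cmod y <= 3 ->
     Cmod (u * x + v * y)%C <= 3 * (Cmod u + Cmod v)).
  { intros x y u v Hx Hy. eapply Rle_trans; [apply Cmod_triangle|].
    rewrite !Cmod_mult. pose proof (Cmod_ge_0 u). pose proof (Cmod_ge_0 v). nra. }
  split.
  (* The diagonal entries [al] and [Cconj al] are close to [1 - i A] and [1 + i A], so [a] and [b]
     turn in opposite directions. The factor 3 is the bound on the orbit. *)
  - apply (no_limit_of_rotation a (- Ci) A (fun q => 3 * (e q + Cmod (be q))) (/ 4)); auto.
    + now rewrite Cmod_opp, Cmod_Ci.
    + lra.
    + intros q. apply Hbd.
    + intros q. rewrite Ha.
      replace (al q * a q + Cconj (be q) * b q - a q - - Ci * RtoC (A q) * a q)%C with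
        ((al q - 1 + Ci * RtoC (A q)) * a q + Cconj (be q) * b q)%C by ring.
      pose proof (Hbd q) as Hq. pose proof (Cmod_ge_0 (a q)). pose proof (Cmod_ge_0 (b q)).
      eapply Rle_trans; [apply E; lra|]. rewrite Cmod_conj. pose proof (He q). lra.
  - apply (no_limit_of_rotation b Ci A (fun q => 3 * (e q + Cmod (be q))) (/ 4)); auto.
    + apply Cmod_Ci.
    + lra.
    + intros q. apply Hbd.
    + intros q. rewrite Hb.
      replace (be q * a q + Cconj (al q) * b q - b q - Ci * RtoC (A q) * b q)%C with
        (Cconj (al q - 1 + Ci * RtoC (A q)) * b q + be q * a q)%C.
      * pose proof (Hbd q) as Hq. pose proof (Cmod_ge_0 (a q)). pose proof (Cmod_ge_0 (b q)).
        eapply Rle_trans; [apply E; lra|]. rewrite Cmod_conj. pose proof (He q). lra.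
      * rewrite Cplus_conj, Cminus_conj, Cmult_conj.
        replace (Cconj 1) with (RtoC 1) by (unfold Cconj, RtoC; simpl; f_equal; ring).
        replace (Cconj (RtoC (A q))) with (RtoC (A q))
          by (unfold Cconj, RtoC; simpl; f_equal; ring).
        replace (Cconj Ci) with (- Ci)%C by (unfold Cconj, Ci, Copp; simpl; f_equal; ring).
        ring.
Qed.

(** * One block: the Picard expansion up to second order *)

Fixpoint csum (f : nat -> C) (n : nat) : C :=
  match n with O => RtoC 0 | S k => (csum f k + f k)%C end.

Lemma csum_S (f : nat -> C) (n : nat) : csum f (S n) = (csum f n + f n)%C.
Proof. reflexivity. Qed.

Lemma csum_Cmod (f : nat -> C) (n : nat) : Cmod (csum f n) <= rsum (fun i => Cmod (f i)) n.
Proof.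
  induction n as [|n IH]; simpl; [rewrite Cmod_0; lra|].
  eapply Rle_trans; [apply Cmod_triangle|]. lra.
Qed.

Lemma csum_scal (c : C) (f : nat -> C) (n : nat) :
  csum (fun i => c * f i)%C n = (c * csum f n)%C.
Proof. induction n as [|n IH]; simpl; [ring|rewrite IH; ring]. Qed.

Lemma csum_ext (f g : nat -> C) (n : nat) : (forall i, f i = g i) -> csum f n = csum g n.
Proof. intros H; induction n as [|n IH]; simpl; [auto|now rewrite IH, H]. Qed.

(* First column of the product of the matrices (1, conj g_i; g_i, 1), i < n,
   without the normalising factors (1 - |g_i|^2)^(-1/2). *)
Fixpoint hat (g : nat -> C) (n : nat) : C * C :=
  match n with
  | O => (RtoC 1, RtoC 0)
  | S k => let (a, b) := hat g k in ((a + Cconj (g k) * b)%C, (b + g k * a)%C)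
  end.

Definition hat_a (g : nat -> C) (n : nat) : C := fst (hat g n).
Definition hat_b (g : nat -> C) (n : nat) : C := snd (hat g n).

Lemma hat_a_S (g : nat -> C) (n : nat) :
  hat_a g (S n) = (hat_a g n + Cconj (g n) * hat_b g n)%C.
Proof. unfold hat_a, hat_b; simpl; now destruct (hat g n). Qed.

Lemma hat_b_S (g : nat -> C) (n : nat) :
  hat_b g (S n) = (hat_b g n + g n * hat_a g n)%C.
Proof. unfold hat_a, hat_b; simpl; now destruct (hat g n). Qed.

(* Summation by parts puts [hat_b] in the form [csum g * hat_a - Q]; the
   increments of [Q] carry the extra factor [csum g], which is small when the
   phases of [g] rotate, although the [Cmod (g i)] alone sum to [ell] only. *)
Lemma hat_estimates (g : nat -> C) (L : nat) (r ell : R) :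
  (forall n, (n <= L)%nat -> Cmod (csum g n) <= r) ->
  (forall n, (n <= L)%nat -> rsum (fun i => Cmod (g i)) n <= ell) ->
  4 * r * ell <= 1 ->
  forall n, (n <= L)%nat ->
    Cmod (hat_b g n) <= 2 * r /\
    Cmod (hat_a g n - 1)%C <= 2 * r * ell /\
    Cmod (hat_b g n - csum g n)%C <= 4 * ell * r ^ 2 /\
    Cmod (hat_a g n - 1 - csum (fun i => Cconj (g i) * csum g i)%C n)%C
      <= 4 * ell ^ 2 * r ^ 2.
Proof.
  intros Hr Hl Hsm.
  assert (r0 : 0 <= r) by (eapply Rle_trans; [apply Cmod_ge_0|apply (Hr O); lia]).
  assert (l0 : 0 <= ell) by (apply (Hl O); lia).
  set (s := rsum (fun i => Cmod (g i))) in *.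
  assert (s0 : forall n, 0 <= s n) by (intro; apply rsum_ge_0; intro; apply Cmod_ge_0).
  set (Q := fun n => (csum g n * hat_a g n - hat_b g n)%C).
  assert (Hb : forall n, (n <= L)%nat -> Cmod (hat_a g n - 1)%C <= 2 * r * ell ->
            Cmod (Q n) <= 2 * r ^ 2 * ell ->
            Cmod (hat_b g n - csum g n)%C <= 4 * ell * r ^ 2).
  { intros n Hn H1 H2.
    replace (hat_b g n - csum g n)%C with (csum g n * (hat_a g n - 1) - Q n)%C
      by (unfold Q; ring).
    eapply Rle_trans; [apply Cmod_triangle_minus|]. rewrite Cmod_mult.
    pose proof (Hr n Hn). pose proof (Cmod_ge_0 (hat_a g n - 1)).
    pose proof (Cmod_ge_0 (csum g n)). nra. }
  (* The induction carries the running sum [s n] in place of [ell], so that each increment is paid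
     for by one [Cmod (g n)]. *)
  assert (H : forall n, (n <= L)%nat ->
    Cmod (hat_b g n) <= 2 * r /\ Cmod (hat_a g n - 1)%C <= 2 * r * s n /\
    Cmod (Q n) <= 2 * r ^ 2 * s n /\
    Cmod (hat_b g n - csum g n)%C <= 4 * ell * r ^ 2 /\
    Cmod (hat_a g n - 1 - csum (fun i => Cconj (g i) * csum g i)%C n)%C
      <= 4 * ell * r ^ 2 * s n).
  { induction n as [|n IH]; intros Hn.
    - unfold Q, hat_a, hat_b; simpl.
      replace (1 - 1 - 0)%C with (RtoC 0) by ring.
      replace (0 * 1 - 0)%C with (RtoC 0) by ring.
      replace (1 - 1)%C with (RtoC 0) by ring. replace (0 - 0)%C with (RtoC 0) by ring.
      rewrite !Cmod_0. unfold s; simpl. assert (0 <= ell * r ^ 2) by nra. repeat split; nra.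
    - destruct (IH ltac:(lia)) as (I1 & I2 & I3 & I4 & I5).
      assert (Es : s (S n) = s n + Cmod (g n)) by reflexivity.
      pose proof (Hl (S n) Hn) as Hls. pose proof (Hr (S n) Hn) as Hrs.
      pose proof (Cmod_ge_0 (g n)) as g0.
      assert (J2 : Cmod (hat_a g (S n) - 1)%C <= 2 * r * s (S n)).
      { rewrite hat_a_S.
        replace (hat_a g n + Cconj (g n) * hat_b g n - 1)%C with
          ((hat_a g n - 1) + Cconj (g n) * hat_b g n)%C by ring.
        eapply Rle_trans; [apply Cmod_triangle|]. rewrite Cmod_mult, Cmod_conj, Es. nra. }
      assert (J3 : Cmod (Q (S n)) <= 2 * r ^ 2 * s (S n)).
      { replace (Q (S n)) with (Q n + csum g (S n) * (Cconj (g n) * hat_b g n))%C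
          by (unfold Q; rewrite hat_a_S, hat_b_S; simpl csum; ring).
        eapply Rle_trans; [apply Cmod_triangle|].
        rewrite !Cmod_mult, Cmod_conj, Es.
        assert (Cmod (csum g (S n)) * (Cmod (g n) * Cmod (hat_b g n))
                <= r * (Cmod (g n) * (2 * r))); [|nra].
        pose proof (Cmod_ge_0 (hat_b g n)).
        apply Rmult_le_compat; auto using Cmod_ge_0; nra. }
      assert (J2' : Cmod (hat_a g (S n) - 1)%C <= 2 * r * ell) by nra.
      assert (J3' : Cmod (Q (S n)) <= 2 * r ^ 2 * ell) by (pose proof (pow2_ge_0 r); nra).
      pose proof (Hb (S n) Hn J2' J3') as J4.
      split; [|split; [|split; [|split]]]; auto.
      + pose proof (Cmod_triangle (hat_b g (S n) - csum g (S n)) (csum g (S n))) as T.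
        replace (hat_b g (S n) - csum g (S n) + csum g (S n))%C with (hat_b g (S n)) in T by ring.
        nra.
      + rewrite hat_a_S, Es. simpl csum.
        replace (hat_a g n + Cconj (g n) * hat_b g n - 1
                 - (csum (fun i => Cconj (g i) * csum g i) n + Cconj (g n) * csum g n))%C
          with ((hat_a g n - 1 - csum (fun i => Cconj (g i) * csum g i) n)
                + Cconj (g n) * (hat_b g n - csum g n))%C by ring.
        eapply Rle_trans; [apply Cmod_triangle|]. rewrite Cmod_mult, Cmod_conj. nra. }
  intros n Hn. destruct (H n Hn) as (H1 & H2 & H3 & H4 & H5).
  pose proof (Hl n Hn) as Hln. pose proof (s0 n).
  assert (0 <= 4 * ell * r ^ 2) by (pose proof (pow2_ge_0 r); nra).
  repeat split; auto; nra.
Qed.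

Fixpoint nrm (g : nat -> C) (n : nat) : R :=
  match n with O => 1 | S k => nrm g k * / sqrt (1 - Cmod (g k) ^ 2) end.

Lemma nrm_S (g : nat -> C) (n : nat) :
  nrm g (S n) = nrm g n * / sqrt (1 - Cmod (g n) ^ 2).
Proof. reflexivity. Qed.

(** Each unnormalised factor has determinant [1 - Cmod (g n) ^ 2] and multiplies the indefinite form
    by it; the square of the normalising factor cancels this. *)
Lemma hat_det (g : nat -> C) (n : nat) :
  (forall i, (i < n)%nat -> Cmod (g i) < 1) ->
  nrm g n ^ 2 * (Cmod (hat_a g n) ^ 2 - Cmod (hat_b g n) ^ 2) = 1.
Proof.
  induction n as [|n IH]; intros Hg.
  - unfold hat_a, hat_b; simpl. rewrite Cmod_0, Cmod_1. ring.
  - rewrite hat_a_S, hat_b_S, nrm_S.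
    assert (E : Cmod (hat_a g n + Cconj (g n) * hat_b g n)%C ^ 2
                - Cmod (hat_b g n + g n * hat_a g n)%C ^ 2
                = (1 - Cmod (g n) ^ 2) * (Cmod (hat_a g n) ^ 2 - Cmod (hat_b g n) ^ 2)).
    { rewrite !Cmod2_alt. destruct (hat_a g n), (hat_b g n), (g n).
      unfold Re, Im, Cplus, Cmult, Cconj; simpl. ring. }
    rewrite E. pose proof (Hg n ltac:(lia)). pose proof (Cmod_ge_0 (g n)).
    assert (Hv : 0 < 1 - Cmod (g n) ^ 2) by nra.
    pose proof (sqrt_lt_R0 _ Hv) as Hs. pose proof (pow2_sqrt _ (Rlt_le _ _ Hv)) as Hs2.
    specialize (IH (fun i Hi => Hg i ltac:(lia))).
    transitivity (nrm g n ^ 2 * (Cmod (hat_a g n) ^ 2 - Cmod (hat_b g n) ^ 2)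
      * ((1 - Cmod (g n) ^ 2) * (/ sqrt (1 - Cmod (g n) ^ 2)) ^ 2)); [ring|].
    rewrite IH. set (q := sqrt (1 - Cmod (g n) ^ 2)) in *. rewrite <- Hs2. field. lra.
Qed.

Lemma nrm_bounds (g : nat -> C) (L n : nat) (eta : R) :
  (forall i, (i < L)%nat -> Cmod (g i) ^ 2 <= eta) ->
  2 * INR L * eta <= 1 -> eta <= / 2 -> (n <= L)%nat ->
  1 <= nrm g n <= 1 + 2 * INR n * eta.
Proof.
  intros Hg HL He.
  induction n as [|n IH]; intros Hn; [simpl; lra|].
  specialize (IH ltac:(lia)). pose proof (Hg n ltac:(lia)) as Hgn.
  pose proof (pow2_ge_0 (Cmod (g n))) as Hp. set (v := Cmod (g n) ^ 2) in *.
  assert (Hnl : INR n <= INR L) by (apply le_INR; lia). pose proof (pos_INR n) as Hn0.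
  assert (Hs : 0 < sqrt (1 - v)) by (apply sqrt_lt_R0; lra).
  assert (H1 : 1 <= / sqrt (1 - v)).
  { rewrite <- Rinv_1 at 1. apply Rinv_le_contravar; auto.
    apply Rle_trans with (sqrt 1); [apply sqrt_le_1_alt; lra|right; apply sqrt_1]. }
  (* For [0 <= v <= 1/2] one has [(1 + v)^2 (1 - v) >= 1]. *)
  assert (H2 : / sqrt (1 - v) <= 1 + v).
  { assert (1 <= (1 + v) * sqrt (1 - v)).
    { rewrite <- (sqrt_pow2 (1 + v)) by lra. rewrite <- sqrt_mult_alt by nra.
      apply Rle_trans with (sqrt 1); [right; symmetry; apply sqrt_1|].
      apply sqrt_le_1_alt. nra. }
    apply Rmult_le_reg_r with (sqrt (1 - v)); auto. rewrite Rinv_l; lra. }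
  rewrite S_INR, nrm_S. fold v. split; [nra|].
  apply Rle_trans with ((1 + 2 * INR n * eta) * (1 + eta)).
  - apply Rmult_le_compat; lra.
  (* The slope 2 in the bound leaves room for the cross term [2 * INR n * eta * eta <= eta]. *)
  - assert (2 * INR n * eta <= 1) by nra. nra.
Qed.

Fixpoint orbit (g : nat -> C) (v : C * C) (n : nat) : C * C :=
  match n with
  | O => v
  | S k => let (a, b) := orbit g v k in
           let c := RtoC (/ sqrt (1 - Cmod (g k) ^ 2)) in
           ((c * (a + Cconj (g k) * b))%C, (c * (b + g k * a))%C)
  end.

Lemma orbit_S (g : nat -> C) (v : C * C) (n : nat) :
  let c := RtoC (/ sqrt (1 - Cmod (g n) ^ 2)) in
  orbit g v (S n) = ((c * (fst (orbit g v n) + Cconj (g n) * snd (orbit g v n)))%C,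
                     (c * (snd (orbit g v n) + g n * fst (orbit g v n)))%C).
Proof. simpl orbit. now destruct (orbit g v n). Qed.

(** Matrices with columns [(al, be)] and [(conj be, conj al)] are closed under products, so a block
    acts through its first column alone, which [hat] and [nrm] compute. *)
Lemma orbit_block (g : nat -> C) (v : C * C) (p n : nat) :
  let h := fun i => g (p + i)%nat in
  orbit g v (p + n) =
   ((RtoC (nrm h n) * hat_a h n * fst (orbit g v p)
     + Cconj (RtoC (nrm h n) * hat_b h n) * snd (orbit g v p))%C,
    (RtoC (nrm h n) * hat_b h n * fst (orbit g v p)
     + Cconj (RtoC (nrm h n) * hat_a h n) * snd (orbit g v p))%C).
Proof.
  intros h.
  assert (Hc : forall r : R, Cconj (RtoC r) = RtoC r)
    by (intros r; unfold Cconj, RtoC; simpl; f_equal; ring).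
  induction n as [|n IH].
  - rewrite Nat.add_0_r. unfold hat_a, hat_b; simpl. destruct (orbit g v p) as [a b]; simpl.
    rewrite !Cmult_conj, !Hc. f_equal; ring.
  - rewrite Nat.add_succ_r. rewrite orbit_S, IH. cbv [fst snd]. fold (h n).
    rewrite nrm_S, hat_a_S, hat_b_S.
    rewrite !RtoC_mult, !Cmult_conj, !Cplus_conj, !Cmult_conj, !Cconj_conj, !Hc.
    f_equal; ring.
Qed.

(** * One block: parabolic weights on a single frequency *)

(** Summation by parts, kept multiplied by [x - 1] so that it holds at [x = 1] too. *)
Lemma abel_geometric (x : C) (v : nat -> R) (n : nat) :
  ((x - 1) * csum (fun i => RtoC (v i) * x ^ i)%C n =
   RtoC (v n) * x ^ n - RtoC (v O) - x * csum (fun i => RtoC (v (S i) - v i)%R * x ^ i)%C n)%C.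
Proof.
  induction n as [|n IH]; simpl csum.
  - simpl. ring.
  - rewrite Cmult_plus_distr_l, IH, Cpow_S, RtoC_minus. ring.
Qed.

(** The cube normalises the parabola: a block has [l^1] norm at most [eps] and energy of order
    [eps^2 / L], so that [L / 4] blocks have energy of order [eps^2]. *)
Definition weight (eps : R) (L i : nat) : R :=
  eps * (INR i * (INR L - INR i)) / INR L ^ 3.

Lemma weight_bounds (eps : R) (L i : nat) :
  0 <= eps -> (0 < L)%nat -> (i <= L)%nat -> 0 <= weight eps L i <= eps / INR L.
Proof.
  intros He HL Hi. apply lt_0_INR in HL. apply le_INR in Hi. pose proof (pos_INR i).
  assert (Hp : 0 < INR L ^ 3) by (apply pow_lt; auto).
  unfold weight. split.
  - apply Rmult_le_pos; [|left; now apply Rinv_0_lt_compat].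
    apply Rmult_le_pos; auto. apply Rmult_le_pos; lra.
  - replace (eps / INR L) with (eps * INR L ^ 2 / INR L ^ 3) by (field; lra).
    apply Rmult_le_compat_r; [left; now apply Rinv_0_lt_compat|].
    apply Rmult_le_compat_l; auto. nra.
Qed.

Lemma weight_0 (eps : R) (L : nat) : weight eps L 0 = 0.
Proof. unfold weight; simpl; unfold Rdiv; ring. Qed.

Lemma weight_last (eps : R) (L : nat) : weight eps L L = 0.
Proof. unfold weight; unfold Rdiv; ring. Qed.

Lemma rsum_le_const (f : nat -> R) (c : R) (L n : nat) :
  (forall i, (i < L)%nat -> f i <= c) -> 0 <= c -> (n <= L)%nat -> rsum f n <= INR L * c.
Proof.
  intros Hf Hc Hn. apply Rle_trans with (INR n * c).
  - rewrite <- rsum_const. apply rsum_le. intros i Hi; apply Hf; lia.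
  - apply Rmult_le_compat_r; auto. now apply le_INR.
Qed.

(** This difference is affine in [i] and the next one is the constant [- 2 * eps / L^3]; hence two
    summations by parts suffice. *)
Definition dweight (eps : R) (L i : nat) : R := weight eps L (S i) - weight eps L i.

Lemma dweight_eq (eps : R) (L i : nat) : (0 < L)%nat ->
  dweight eps L i = eps / INR L ^ 3 * (INR L - 1 - 2 * INR i).
Proof.
  intros HL; apply lt_0_INR in HL. unfold dweight, weight. rewrite S_INR. field. lra.
Qed.

Lemma dweight_bound (eps : R) (L i : nat) : 0 <= eps -> (0 < L)%nat -> (i <= L)%nat ->
  Rabs (dweight eps L i) <= 2 * eps / INR L ^ 2.
Proof.
  intros He HL Hi. rewrite dweight_eq by auto. apply le_INR in Hi. pose proof (pos_INR i).
  assert (H1 : 1 <= INR L) by (apply (le_INR 1); lia).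
  assert (Hp : 0 < INR L ^ 3) by (apply pow_lt; lra).
  rewrite Rabs_mult, Rabs_pos_eq
    by (apply Rmult_le_pos; [auto|left; now apply Rinv_0_lt_compat]).
  replace (2 * eps / INR L ^ 2) with (eps / INR L ^ 3 * (2 * INR L)) by (field; lra).
  apply Rmult_le_compat_l.
  - apply Rmult_le_pos; [auto|left; now apply Rinv_0_lt_compat].
  - apply Rabs_le. lra.
Qed.

Section Frequency.
Variables (eps : R) (L : nat) (x : C).
Hypothesis eps_pos : 0 <= eps.
Hypothesis L_pos : (0 < L)%nat.
Hypothesis x_unit : Cmod x = 1.

(** The distance from resonance in units of [1 / L], the frequency resolution of a block. *)
Let y := INR L * Cmod (x - 1)%C.
Let T (v : nat -> R) (n : nat) : C := csum (fun i => RtoC (v i) * x ^ i)%C n.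

Lemma Cmod_unit_pow (i : nat) : Cmod (x ^ i)%C = 1.
Proof. now rewrite Cmod_pow, x_unit, pow1. Qed.

Lemma Cmod_term (r : R) (i : nat) : Cmod (RtoC r * x ^ i)%C = Rabs r.
Proof. rewrite Cmod_mult, Cmod_R, Cmod_unit_pow. ring. Qed.

(** After summation by parts, the two boundary terms and the total of the constant second
    differences are each at most [2 * eps / L^2]. *)
Lemma dweight_sum_bound (n : nat) : (n <= L)%nat ->
  y * Cmod (T (dweight eps L) n) <= 6 * eps / INR L.
Proof.
  intros Hn. assert (HL : 0 < INR L) by now apply lt_0_INR.
  unfold y. rewrite Rmult_assoc, <- Cmod_mult. unfold T.
  rewrite abel_geometric.
  apply Rle_trans with (INR L * (2 * eps / INR L ^ 2 + 2 * eps / INR L ^ 2 + 2 * eps / INR L ^ 2)).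
  2: right; field; lra.
  apply Rmult_le_compat_l; [lra|].
  eapply Rle_trans; [apply Cmod_triangle_minus|]. apply Rplus_le_compat.
  - eapply Rle_trans; [apply Cmod_triangle_minus|]. rewrite Cmod_term, Cmod_R.
    apply Rplus_le_compat; apply dweight_bound; auto; lia.
  - rewrite Cmod_mult, x_unit, Rmult_1_l. eapply Rle_trans; [apply csum_Cmod|].
    eapply Rle_trans; [apply rsum_le_const with (L := L) (c := 2 * eps / INR L ^ 3)|].
    + intros i Hi. rewrite Cmod_term, !dweight_eq by auto. rewrite S_INR.
      right. replace (_ - _) with (- (2 * eps / INR L ^ 3)) by (field; lra).
      rewrite Rabs_Ropp, Rabs_pos_eq; auto.
      apply Rmult_le_pos; [lra|left; apply Rinv_0_lt_compat, pow_lt; lra].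
    + apply Rmult_le_pos; [lra|left; apply Rinv_0_lt_compat, pow_lt; lra].
    + exact Hn.
    + right; field; lra.
Qed.

Lemma weight_sum_le_eps (n : nat) : (n <= L)%nat ->
  rsum (fun i => Cmod (RtoC (weight eps L i) * x ^ i)%C) n <= eps.
Proof.
  intros Hn. assert (HL : 0 < INR L) by now apply lt_0_INR.
  eapply Rle_trans; [apply rsum_le_const with (L := L) (c := eps / INR L)|].
  - intros i Hi. rewrite Cmod_term. pose proof (weight_bounds eps L i eps_pos L_pos ltac:(lia)).
    rewrite Rabs_pos_eq; lra.
  - apply Rmult_le_pos; [auto|left; now apply Rinv_0_lt_compat].
  - exact Hn.
  - right; field; lra.
Qed.

(** At an intermediate [n] the boundary term at [n] survives, so only one power of [y] is gained. *)
Lemma weight_partial_sum_bound (n : nat) : (n <= L)%nat ->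
  y * Cmod (T (weight eps L) n) <= 3 * eps.
Proof.
  intros Hn. assert (HL : 0 < INR L) by now apply lt_0_INR.
  unfold y. rewrite Rmult_assoc, <- Cmod_mult. unfold T. rewrite abel_geometric, weight_0.
  apply Rle_trans with (INR L * (eps / INR L + 0 + 2 * eps / INR L)); [|right; field; lra].
  apply Rmult_le_compat_l; [lra|].
  eapply Rle_trans; [apply Cmod_triangle_minus|]. apply Rplus_le_compat.
  - eapply Rle_trans; [apply Cmod_triangle_minus|]. rewrite Cmod_term, Cmod_R, Rabs_R0.
    pose proof (weight_bounds eps L n eps_pos L_pos Hn). rewrite Rabs_pos_eq; lra.
  - rewrite Cmod_mult, x_unit, Rmult_1_l. eapply Rle_trans; [apply csum_Cmod|].
    eapply Rle_trans; [apply rsum_le_const with (L := L) (c := 2 * eps / INR L ^ 2)|].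
    + intros i Hi. rewrite Cmod_term. apply dweight_bound; auto; lia.
    + apply Rmult_le_pos; [lra|left; apply Rinv_0_lt_compat, pow_lt; lra].
    + exact Hn.
    + right; field; lra.
Qed.

(** At [n = L] both boundary terms vanish and what remains is a sum of [dweight], to which a second
    summation by parts applies. *)
Lemma weight_full_sum_bound : y ^ 2 * Cmod (T (weight eps L) L) <= 6 * eps.
Proof.
  assert (HL : 0 < INR L) by now apply lt_0_INR.
  pose proof (dweight_sum_bound L (le_n L)) as H.
  assert (E : y * Cmod (T (weight eps L) L) = INR L * Cmod (T (dweight eps L) L)).
  { unfold y. rewrite Rmult_assoc, <- Cmod_mult. unfold T at 1.
    rewrite abel_geometric, weight_0, weight_last. f_equal.
    fold (dweight eps L). change (csum _ L) with (T (dweight eps L) L).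
    replace (0 * x ^ L - 0 - x * T (dweight eps L) L)%C
      with (- (x * T (dweight eps L) L))%C by ring.
    now rewrite Cmod_opp, Cmod_mult, x_unit, Rmult_1_l. }
  replace (y ^ 2 * Cmod (T (weight eps L) L)) with (INR L * (y * Cmod (T (dweight eps L) L)))
    by (rewrite (Rmult_comm y), <- Rmult_assoc, <- E; ring).
  apply Rle_trans with (INR L * (6 * eps / INR L)); [|right; field; lra].
  apply Rmult_le_compat_l; lra.
Qed.

(* The leading part of the area swept by the partial sums is the
   coefficient [1 / (x - 1)], which is what produces the logarithm. *)
Lemma weight_area_bound :
  y * (INR L * Cmod
      ((x - 1) * csum (fun i => RtoC (weight eps L i) * Cconj (x ^ i) * T (weight eps L) i) L
      - RtoC (rsum (fun i => weight eps L i ^ 2)%R L))%C) <= 6 * eps ^ 2.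
Proof.
  assert (HL : 0 < INR L) by now apply lt_0_INR.
  (* Insert the summation by parts for [(x - 1) * T (weight eps L) n]: since [x^n] times its
     conjugate is 1, the boundary term contributes exactly the squared weights. *)
  assert (E : forall n,
      ((x - 1) * csum (fun i => RtoC (weight eps L i) * Cconj (x ^ i) * T (weight eps L) i) n
      - RtoC (rsum (fun i => weight eps L i ^ 2)%R n)
      = - csum (fun i => RtoC (weight eps L i) * Cconj (x ^ i) * (x * T (dweight eps L) i)) n)%C).
  { induction n as [|n IH]; [simpl; ring|].
    rewrite !csum_S, rsum_S, Cmult_plus_distr_l, RtoC_plus.
    assert (HA : ((x - 1) * T (weight eps L) n =
      RtoC (weight eps L n) * x ^ n - 0 - x * T (dweight eps L) n)%C).
    { unfold T. rewrite abel_geometric, weight_0. reflexivity. }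
    assert (HU : (x ^ n * Cconj (x ^ n))%C = 1) by (apply unit_mul_conj, Cmod_unit_pow).
    set (X := (x ^ n)%C) in *. set (X' := Cconj X) in *. set (w := weight eps L n) in *.
    set (Tn := T (weight eps L) n) in *. set (Dn := T (dweight eps L) n) in *.
    match type of IH with (?a - ?b = _)%C =>
      transitivity ((a - b) + (RtoC w * X' * ((x - 1) * Tn) - RtoC (w ^ 2)%R))%C end.
    { unfold w; ring. }
    rewrite IH, HA, RtoC_pow.
    replace (RtoC w * X' * (RtoC w * X - 0 - x * Dn) - RtoC w ^ 2)%C with
      (RtoC w * RtoC w * (X * X') - RtoC w * RtoC w - RtoC w * X' * (x * Dn))%C by ring.
    rewrite HU. ring. }
  rewrite E, Cmod_opp.
  rewrite <- Rmult_assoc, (Rmult_comm y), Rmult_assoc.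
  apply Rle_trans with (INR L * (eps * (6 * eps / INR L))); [|right; field; lra].
  apply Rmult_le_compat_l; [lra|].
  assert (y0 : 0 <= y) by (apply Rmult_le_pos; [lra|apply Cmod_ge_0]).
  apply Rle_trans with (y * rsum (fun i =>
    Cmod (RtoC (weight eps L i) * Cconj (x ^ i) * (x * T (dweight eps L) i))%C) L).
  { apply Rmult_le_compat_l; auto. apply csum_Cmod. }
  rewrite <- rsum_scal.
  apply Rle_trans with (INR L * (eps / INR L * (6 * eps / INR L))); [|right; field; lra].
  apply rsum_le_const with (L := L); auto.
  - intros i Hi. rewrite !Cmod_mult, Cmod_conj, Cmod_unit_pow, x_unit, Cmod_R.
    pose proof (weight_bounds eps L i eps_pos L_pos ltac:(lia)) as Hw.
    rewrite Rabs_pos_eq by lra.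
    pose proof (dweight_sum_bound i ltac:(lia)) as Hd.
    replace (y * (weight eps L i * 1 * (1 * Cmod (T (dweight eps L) i)))) with
      (weight eps L i * (y * Cmod (T (dweight eps L) i))) by ring.
    apply Rmult_le_compat; try lra. apply Rmult_le_pos; auto. apply Cmod_ge_0.
  - assert (0 <= eps / INR L) by (apply Rmult_le_pos; [auto|left; now apply Rinv_0_lt_compat]).
    assert (0 <= 6 * eps / INR L) by (apply Rmult_le_pos; [lra|left; now apply Rinv_0_lt_compat]).
    now apply Rmult_le_pos.
Qed.

End Frequency.

Lemma weight_energy (eps : R) (L : nat) : (2 <= L)%nat ->
  eps ^ 2 / (60 * INR L) <= rsum (fun i => weight eps L i ^ 2) L <= eps ^ 2 / INR L.
Proof.
  intros HL. apply le_INR in HL. simpl (INR 2) in HL.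
  (* Closed forms of the sums of [i^2], [i^3] and [i^4]; at [n = L] they collapse to
     [eps^2 / L * (1 - L^-4) / 30]. *)
  assert (E : forall n, rsum (fun i => weight eps L i ^ 2) n =
    (eps / INR L ^ 3) ^ 2 * (let m := INR n in let l := INR L in
      l ^ 2 * (m * (m - 1) * (2 * m - 1) / 6) - 2 * l * (m * (m - 1) / 2) ^ 2
      + m * (m - 1) * (2 * m - 1) * (3 * m ^ 2 - 3 * m - 1) / 30)).
  { induction n as [|n IH]; [simpl; field; lra|].
    rewrite rsum_S, IH. unfold weight. rewrite S_INR. cbv zeta. field. lra. }
  rewrite E. cbv zeta. set (l := INR L) in *.
  replace ((eps / l ^ 3) ^ 2 * _) with (eps ^ 2 / l * ((1 - / l ^ 4) / 30)) by (field; lra).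
  assert (Hq : 0 <= eps ^ 2 / l)
    by (apply Rmult_le_pos; [apply pow2_ge_0|left; apply Rinv_0_lt_compat; lra]).
  assert (Hi : 0 < / l ^ 4 <= / 2).
  { split; [apply Rinv_0_lt_compat, pow_lt; lra|].
    apply Rinv_le_contravar; [lra|]. assert (4 <= l ^ 2) by nra. simpl in *; nra. }
  replace (eps ^ 2 / (60 * l)) with (eps ^ 2 / l * (/ 60)) by (field; lra).
  split; [apply Rmult_le_compat_l; lra|]. nra.
Qed.

(** With [W] the sum of squared weights and [cis theta] different from 1,
    [W / (cis theta - 1) = - W / 2 - i * area]. *)
Definition area (eps : R) (L : nat) (theta : R) : R :=
  rsum (fun i => weight eps L i ^ 2) L * sin theta / (2 - 2 * cos theta).

Lemma Cmod_cis_minus_1 (theta : R) : Cmod (cis theta - 1)%C ^ 2 = 2 - 2 * cos theta.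
Proof.
  rewrite Cmod2_alt. unfold cis, Cminus, Cplus, Copp, RtoC, Re, Im; simpl.
  pose proof (sin2_cos2 theta) as H. unfold Rsqr in H. nra.
Qed.

(** The unit factor [u] stands for the power of [z] accumulated before the block. *)
Definition block_g (eps : R) (L : nat) (u x : C) (i : nat) : C :=
  (u * (RtoC (weight eps L i) * x ^ i))%C.

(** [hat_estimates] is used twice: with the trivial bound [r = eps] on the partial sums, which
    serves near resonance, and with [r = 3 * eps / y], which gives the decay away from it. *)
Lemma block_transfer (eps theta : R) (L : nat) (u : C) :
  0 < eps <= / 10 -> (2 <= L)%nat -> Cmod u = 1 ->
  let x := cis theta in
  let y := INR L * Cmod (x - 1)%C in
  let g := block_g eps L u x in
  let al := (RtoC (nrm g L) * hat_a g L)%C in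
  let be := (RtoC (nrm g L) * hat_b g L)%C in
  Cmod al ^ 2 = 1 + Cmod be ^ 2 /\
  Cmod be <= 4 * eps /\ Cmod (al - 1)%C <= 8 * eps ^ 2 /\
  (/ 5 <= y -> Cmod be <= 14 * eps / y ^ 2 /\
     Cmod (al - 1 + Ci * RtoC (area eps L theta))%C <= 7 * eps ^ 2 / y ^ 2 + 5 * eps ^ 2 / INR L).
Proof.
  intros He HL Hu x y g al be.
  assert (e0 : 0 <= eps) by lra. assert (L0 : (0 < L)%nat) by lia.
  assert (Hx : Cmod x = 1) by apply Cmod_cis.
  assert (HL2 : 2 <= INR L) by (apply le_INR in HL; simpl in HL; lra).
  set (T := csum (fun i => RtoC (weight eps L i) * x ^ i)%C).
  assert (Hg : forall i, Cmod (g i) = Cmod (RtoC (weight eps L i) * x ^ i)%C)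
    by (intros i; unfold g, block_g; rewrite (Cmod_mult u), Hu; ring).
  assert (Hgw : forall i, (i < L)%nat -> Cmod (g i) <= eps / INR L).
  { intros i Hi. rewrite Hg, (Cmod_term x Hx).
    pose proof (weight_bounds eps L i e0 L0 ltac:(lia)). rewrite Rabs_pos_eq; lra. }
  assert (Hel : 0 <= eps / INR L) by (apply Rmult_le_pos; [auto|left; apply Rinv_0_lt_compat; lra]).
  assert (HeL : eps / INR L * INR L = eps) by (field; lra).
  assert (HS : forall n, csum g n = (u * T n)%C) by (intros n; unfold g, block_g; apply csum_scal).
  assert (HSm : forall n, Cmod (csum g n) = Cmod (T n))
    by (intros n; rewrite HS, Cmod_mult, Hu; ring).
  assert (Hl : forall n, (n <= L)%nat -> rsum (fun i => Cmod (g i)) n <= eps).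
  { intros n Hn. rewrite (rsum_ext _ _ n (fun i _ => Hg i)).
    now apply weight_sum_le_eps. }
  assert (HN : 1 <= nrm g L <= 1 + 2 * (eps ^ 2 / INR L)).
  { assert (Hb : forall i, (i < L)%nat -> Cmod (g i) ^ 2 <= (eps / INR L) ^ 2).
    { intros i Hi. apply pow_incr. split; [apply Cmod_ge_0|auto]. }
    replace (1 + 2 * (eps ^ 2 / INR L)) with (1 + 2 * INR L * (eps / INR L) ^ 2) by (field; lra).
    apply nrm_bounds with (L := L); auto; nra. }
  assert (HeL2 : 0 <= eps ^ 2 / INR L <= eps ^ 2 / 2).
  { replace (eps ^ 2 / INR L) with (eps * (eps / INR L)) by (field; lra). nra. }
  assert (Hmul : forall v : C, Cmod (RtoC (nrm g L) * v)%C = nrm g L * Cmod v)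
    by (intros v; apply Cmod_scal; lra).
  destruct (hat_estimates g L eps eps) with (n := L) as (C1 & C2 & _ & _); auto.
  { intros n Hn. eapply Rle_trans; [apply csum_Cmod|auto]. }
  { nra. }
  assert (Ha2 : Cmod (hat_a g L) <= 2).
  { pose proof (Cmod_triangle (hat_a g L - 1) 1) as H.
    replace (hat_a g L - 1 + 1)%C with (hat_a g L) in H by ring. rewrite Cmod_1 in H. nra. }
  assert (Hal : forall v : C, Cmod (al + v)%C <= Cmod (hat_a g L + v)%C + 4 * (eps ^ 2 / INR L)).
  { intros v. replace (al + v)%C with ((hat_a g L + v) + RtoC (nrm g L - 1) * hat_a g L)%C
      by (unfold al; rewrite RtoC_minus; ring).
    eapply Rle_trans; [apply Cmod_triangle|]. rewrite Cmod_scal by lra.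
    pose proof (Cmod_ge_0 (hat_a g L)). nra. }
  split; [|split; [|split]].
  - pose proof (hat_det g L) as Hd. unfold al, be. rewrite !Hmul.
    assert (Hg1 : forall i, (i < L)%nat -> Cmod (g i) < 1).
    { intros i Hi. specialize (Hgw i Hi). nra. }
    specialize (Hd Hg1). rewrite !Rpow_mult_distr. lra.
  - unfold be. rewrite Hmul. pose proof (Cmod_ge_0 (hat_b g L)). nra.
  - unfold Cminus at 1. eapply Rle_trans; [apply Hal|].
    fold (hat_a g L - 1)%C. nra.
  - intros Hy. set (r := 3 * eps / y).
    (* This is where [y >= 1/5] enters: it secures the smallness condition [4 * r * eps <= 1]. *)
    assert (Hr : 0 < r <= 15 * eps).
    { unfold r. split; [apply Rdiv_lt_0_compat; lra|].
      apply Rmult_le_reg_r with y; [lra|]. unfold Rdiv. rewrite Rmult_assoc, Rinv_l by lra. nra. }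
    destruct (hat_estimates g L r eps) with (n := L) as (_ & _ & D3 & D4); auto.
    { intros n Hn. rewrite HSm. apply Rmult_le_reg_l with y; [lra|].
      unfold r. replace (y * (3 * eps / y)) with (3 * eps) by (field; lra).
      pose proof (weight_partial_sum_bound eps L x e0 L0 Hx n Hn) as H. exact H. }
    { nra. }
    assert (Hr2 : r ^ 2 = 9 * eps ^ 2 / y ^ 2) by (unfold r; field; lra).
    assert (Hy2 : 0 < y ^ 2) by (apply pow_lt; lra).
    set (q := / y ^ 2). assert (Hq : 0 < q) by now apply Rinv_0_lt_compat.
    replace (9 * eps ^ 2 / y ^ 2) with (9 * eps ^ 2 * q) in Hr2 by reflexivity.
    replace (14 * eps / y ^ 2) with (14 * eps * q) by reflexivity.
    replace (7 * eps ^ 2 / y ^ 2) with (7 * eps ^ 2 * q) by reflexivity.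
    assert (Heq : 0 <= eps * q) by nra.
    rewrite Hr2 in D3, D4. split.
    + assert (HT : Cmod (T L) <= 6 * eps * q).
      { pose proof (weight_full_sum_bound eps L x e0 L0 Hx) as H. cbv zeta in H.
        fold T in H. fold y in H. unfold q.
        apply Rmult_le_reg_l with (y ^ 2); auto.
        replace (y ^ 2 * (6 * eps * / y ^ 2)) with (6 * eps) by (field; lra). exact H. }
      assert (Hb : Cmod (hat_b g L) <= 6 * eps * q + 36 * eps ^ 2 * (eps * q)).
      { pose proof (Cmod_triangle (hat_b g L - csum g L) (csum g L)) as H.
        replace (hat_b g L - csum g L + csum g L)%C with (hat_b g L) in H by ring.
        rewrite HSm in H. nra. }
      assert (He2 : eps ^ 2 <= / 100) by nra.
      assert (Hb' : Cmod (hat_b g L) <= 7 * (eps * q)) by nra.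
      unfold be. rewrite Hmul. pose proof (Cmod_ge_0 (hat_b g L)). nra.
    + set (Z := csum (fun i => Cconj (g i) * csum g i)%C L) in *.
      set (W := rsum (fun i => weight eps L i ^ 2) L).
      assert (HW : 0 <= W <= eps ^ 2 / INR L).
      { split; [apply rsum_ge_0; intro; apply pow2_ge_0|apply (weight_energy eps L HL)]. }
      assert (Hx1 : 0 < Cmod (x - 1)%C) by (unfold y in Hy; nra).
      assert (Hm : 0 < 2 - 2 * cos theta).
      { rewrite <- Cmod_cis_minus_1. now apply pow_lt. }
      (* The second order term [Z] is close to [W / (x - 1)]. Its real part [- W / 2] is only of
         size [eps^2 / L] and goes into the error. *)
      assert (HZ : Cmod (Z + RtoC (W / 2) + Ci * RtoC (area eps L theta))%C <= 6 * eps ^ 2 * q).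
      { pose proof (weight_area_bound eps L x e0 L0 Hx) as H. cbv zeta in H. fold y in H.
        rewrite (csum_ext _ (fun i => Cconj (g i) * csum g i)%C) in H.
        2:{ intros i. rewrite HS. unfold g, block_g. fold T.
            rewrite !Cmult_conj.
            replace (Cconj (RtoC (weight eps L i))) with (RtoC (weight eps L i))
              by (unfold Cconj, RtoC; simpl; f_equal; ring).
            transitivity ((u * Cconj u) * (RtoC (weight eps L i) * Cconj (x ^ i) * T i))%C; [|ring].
            rewrite (unit_mul_conj u Hu), Cmult_1_l. reflexivity. }
        fold Z in H. fold W in H.
        replace ((x - 1) * Z - RtoC W)%C with
          ((x - 1) * (Z + RtoC (W / 2) + Ci * RtoC (area eps L theta)))%C in H.
        2:{ assert (E : ((x - 1) * (RtoC (W / 2) + Ci * RtoC (area eps L theta)) = - RtoC W)%C).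
            { unfold area. fold W. unfold x, cis, Cminus, Cplus, Copp, Cmult, RtoC, Ci; simpl.
              pose proof (sin2_cos2 theta) as Hsc. unfold Rsqr in Hsc.
              f_equal; field_simplify_eq; try lra; nra. }
            transitivity ((x - 1) * Z
              + (x - 1) * (RtoC (W / 2) + Ci * RtoC (area eps L theta)))%C; [ring|].
            rewrite E. ring. }
        rewrite Cmod_mult in H. unfold q.
        apply Rmult_le_reg_l with (y ^ 2); auto.
        replace (y ^ 2 * (6 * eps ^ 2 * / y ^ 2)) with (6 * eps ^ 2) by (field; lra).
        eapply Rle_trans; [|exact H]. right. unfold y. ring. }
      set (A := area eps L theta) in *.
      replace (al - 1 + Ci * RtoC A)%C with (al + (- (1) + Ci * RtoC A))%C by ring.
      eapply Rle_trans; [apply Hal|].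
      replace (hat_a g L + (- (1) + Ci * RtoC A))%C with
        ((hat_a g L - 1 - Z) + ((Z + RtoC (W / 2) + Ci * RtoC A) - RtoC (W / 2)))%C by ring.
      assert (HB : Cmod ((hat_a g L - 1 - Z) + ((Z + RtoC (W / 2) + Ci * RtoC A) - RtoC (W / 2)))%C
         <= 4 * eps ^ 2 * (9 * eps ^ 2 * q) + (6 * eps ^ 2 * q + W / 2)).
      { eapply Rle_trans; [apply Cmod_triangle|]. apply Rplus_le_compat; [exact D4|].
        eapply Rle_trans; [apply Cmod_triangle_minus|]. apply Rplus_le_compat; [exact HZ|].
        rewrite Cmod_R, Rabs_pos_eq; lra. }
      assert (He2 : eps ^ 2 <= / 100) by nra.
      assert (0 <= eps ^ 2 * q) by nra.
      assert (4 * eps ^ 2 * (9 * eps ^ 2 * q) <= eps ^ 2 * q) by nra.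
      replace (5 * eps ^ 2 / INR L) with (5 * (eps ^ 2 / INR L)) by (unfold Rdiv; ring).
      lra.
Qed.

(** * Summing over the frequencies of a stage *)

Lemma sin_ge_cubic (a : R) : 0 <= a <= 4 -> a - a ^ 3 / 6 <= sin a.
Proof.
  intros Ha. destruct (pre_sin_bound a 0 ltac:(lra) ltac:(lra)) as [H _].
  unfold sin_approx, sin_term in H; simpl in H. simpl. lra.
Qed.

Lemma two_minus_two_cos (t : R) : 2 - 2 * cos t = 4 * sin (t / 2) ^ 2.
Proof.
  replace t with (2 * (t / 2)) at 1 by field. rewrite cos_2a_sin. ring.
Qed.

(** The modulus is [2 * |sin (t / 2)|]. The range is 4, the bound on [carg], plus 1/4, the width of
    a stage; it stays clear of the next zero at [2 * PI]. *)
Lemma cis_minus_1_lower (t : R) : Rabs t <= 17 / 4 -> Rabs t / 5 <= Cmod (cis t - 1)%C.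
Proof.
  intros Ht. set (a := Rabs t / 2).
  assert (Ha : 0 <= a <= 17 / 8) by (unfold a; pose proof (Rabs_pos t); lra).
  pose proof (sin_ge_cubic a ltac:(lra)) as Hs.
  assert (Hs2 : a / 5 <= sin a) by (assert (a ^ 2 <= 289 / 64) by nra; nra).
  assert (E : sin (t / 2) ^ 2 = sin a ^ 2).
  { unfold a, Rabs. destruct (Rcase_abs t); auto.
    replace (- t / 2) with (- (t / 2)) by field. rewrite sin_neg. ring. }
  pose proof (Cmod_cis_minus_1 t) as HC. rewrite two_minus_two_cos, E in HC.
  pose proof (Cmod_ge_0 (cis t - 1)).
  replace (Rabs t / 5) with (2 * (a / 5)) by (unfold a; field). nra.
Qed.

(** From [sin t >= t / 2] and [2 - 2 * cos t <= t^2], together with the energy bound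
    [eps^2 / (60 * L)]. *)
Lemma area_lower (eps t : R) (L : nat) :
  (2 <= L)%nat -> 0 < t <= 1 -> eps ^ 2 / 120 * / (INR L * t) <= area eps L t.
Proof.
  intros HL Ht. pose proof (weight_energy eps L HL) as [HW _].
  apply le_INR in HL; simpl (INR 2) in HL. unfold area.
  set (W := rsum _ _) in *.
  pose proof (sin_ge_cubic t ltac:(lra)) as Hs.
  assert (Hs2 : t / 2 <= sin t) by (assert (t ^ 2 <= 1) by nra; nra).
  pose proof (sin_lt_x (t / 2) ltac:(lra)) as Hx.
  pose proof (sin_ge_cubic (t / 2) ltac:(lra)) as Hs'.
  assert (Hs3 : 0 < sin (t / 2)).
  { assert ((t / 2) ^ 2 <= 1) by nra. nra. }
  rewrite two_minus_two_cos. set (m := 4 * sin (t / 2) ^ 2).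
  assert (Hm : 0 < m <= t ^ 2) by (unfold m; nra).
  assert (HW0 : 0 <= eps ^ 2 / (60 * INR L)).
  { apply Rmult_le_pos; [apply pow2_ge_0|left; apply Rinv_0_lt_compat; lra]. }
  replace (eps ^ 2 / 120 * / (INR L * t)) with (eps ^ 2 / (60 * INR L) * (t / 2) * / t ^ 2)
    by (field; lra).
  unfold Rdiv at 3. apply Rmult_le_compat.
  - apply Rmult_le_pos; lra.
  - left; apply Rinv_0_lt_compat, pow_lt; lra.
  - apply Rmult_le_compat; lra.
  - apply Rinv_le_contravar; lra.
Qed.

(** Comparison with the integral of [1 / (1 + v^2)], which changes by a factor at most 3 over a unit
    interval; the arctangents telescope to at most [PI <= 4]. *)
Lemma rsum_inv_quadratic (t : R) (n : nat) : rsum (fun j => / (1 + (t - INR j) ^ 2)) n <= 12.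
Proof.
  assert (Hstep : forall v, / (1 + v ^ 2) <= 3 * (atan (v + 1) - atan v)).
  { intros v.
    destruct (MVT_cor2 atan (fun c => / (1 + c ^ 2)) v (v + 1) ltac:(lra)
      (fun c _ => derivable_pt_lim_atan c)) as (c & Hc & Hvc).
    rewrite Hc. replace (v + 1 - v) with 1 by ring. rewrite Rmult_1_r.
    assert (Hp : 0 < 1 + v ^ 2) by nra. assert (Hp' : 0 < 1 + c ^ 2) by nra.
    apply Rmult_le_reg_r with (1 + v ^ 2); auto. rewrite Rinv_l by lra.
    apply Rmult_le_reg_r with (1 + c ^ 2); auto.
    replace (3 * / (1 + c ^ 2) * (1 + v ^ 2) * (1 + c ^ 2)) with (3 * (1 + v ^ 2)) by (field; lra).
    assert ((c - v) ^ 2 <= 1) by nra. pose proof (pow2_ge_0 (v - (c - v))). nra. }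
  assert (H : rsum (fun j => / (1 + (t - INR j) ^ 2)) n
              <= 3 * (atan (t + 1) - atan (t + 1 - INR n))).
  { induction n as [|n IH].
    - simpl. rewrite Rminus_0_r. lra.
    - rewrite rsum_S, S_INR. specialize (Hstep (t - INR n)).
      replace (t - INR n + 1) with (t + 1 - INR n) in Hstep by ring.
      replace (t + 1 - (INR n + 1)) with (t - INR n) by ring. lra. }
  pose proof (atan_bound (t + 1)). pose proof (atan_bound (t + 1 - INR n)).
  pose proof PI_4. lra.
Qed.

Lemma rsum_harmonic_ge_ln (t : R) (n : nat) :
  INR n <= t -> ln (t + 1) - ln (t - INR n + 1) <= rsum (fun j => / (t - INR j)) n.
Proof.
  induction n as [|n IH]; intros Hn.
  - simpl. rewrite Rminus_0_r. lra.
  - rewrite S_INR in *. rewrite rsum_S. specialize (IH ltac:(lra)).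
    set (v := t - INR n) in *. replace (t - (INR n + 1) + 1) with v by (unfold v; ring).
    assert (Hv : 1 <= v) by (unfold v; lra).
    assert (H : ln (v + 1) - ln v <= / v).
    { replace (v + 1) with (v * (1 + / v)) by (field; lra).
      assert (Hi : 0 < / v) by (apply Rinv_0_lt_compat; lra).
      rewrite ln_mult by lra.
      assert (ln (1 + / v) <= / v); [|lra].
      rewrite <- (ln_exp (/ v)) at 2. apply ln_le; [lra|apply exp_ineq1_le]. }
    lra.
Qed.

(** Within one unit of resonance [area] may blow up; there the rotation is set to 0 and the true one
    counted as error. *)
Definition rot (eps : R) (L j : nat) (tau : R) : R :=
  if Rle_dec 1 (Rabs (INR L * tau - INR j)) then area eps L (tau - INR j / INR L) else 0.

(** Comparable to [min (1, 1 / d^2)], so that one expression bounds both regimes and is summable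
    over [j]. *)
Definition decay (L j : nat) (tau : R) : R := / (1 + (INR L * tau - INR j) ^ 2).

Lemma stage_block (eps tau : R) (J j : nat) (u : C) :
  0 < eps <= / 10 -> (j < J)%nat -> -4 <= tau <= 4 -> Cmod u = 1 ->
  let L := (4 * J)%nat in
  let g := block_g eps L u (cis (tau - INR j / INR L)) in
  let al := (RtoC (nrm g L) * hat_a g L)%C in
  let be := (RtoC (nrm g L) * hat_b g L)%C in
  Cmod al ^ 2 = 1 + Cmod be ^ 2 /\
  Cmod be <= 700 * eps * decay L j tau /\
  Cmod (al - 1 + Ci * RtoC (rot eps L j tau))%C
    <= 350 * eps ^ 2 * decay L j tau + 5 * eps ^ 2 / INR L.
Proof.
  intros He Hj Htau Hu L g al be.
  assert (HJ : INR j + 1 <= INR J) by (rewrite <- S_INR; apply le_INR; lia).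
  pose proof (pos_INR j) as Hj0.
  assert (HL : INR L = 4 * INR J) by (unfold L; rewrite mult_INR; simpl; ring).
  destruct (block_transfer eps (tau - INR j / INR L) L u He ltac:(unfold L; lia) Hu)
    as (B1 & B2 & B3 & B4).
  fold g in B1, B2, B3, B4. fold al in B1, B3, B4. fold be in B1, B2, B4.
  split; [exact B1|].
  set (d := INR L * tau - INR j). unfold rot, decay. fold d.
  set (theta := tau - INR j / INR L) in *.
  assert (Hd : d = INR L * theta) by (unfold d, theta; field; lra).
  set (y := INR L * Cmod (cis theta - 1)%C) in *.
  assert (Hlast : 0 <= 5 * eps ^ 2 / INR L).
  { apply Rmult_le_pos; [nra|left; apply Rinv_0_lt_compat; lra]. }
  assert (He2 : 0 < eps ^ 2) by (apply pow_lt; lra).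
  assert (Hp : 0 < 1 + d ^ 2) by nra.
  assert (Hi : 0 < / (1 + d ^ 2)) by now apply Rinv_0_lt_compat.
  destruct (Rle_dec 1 (Rabs d)) as [Hd1|Hd1].
  - assert (Hth : Rabs theta <= 17 / 4).
    { assert (0 <= INR j / INR L <= / 4).
      { split; [apply Rmult_le_pos; [lra|left; apply Rinv_0_lt_compat; lra]|].
        apply Rmult_le_reg_r with (INR L); [lra|]. unfold Rdiv. rewrite Rmult_assoc, Rinv_l; lra. }
      unfold theta. apply Rabs_le. lra. }
    pose proof (cis_minus_1_lower theta Hth) as Hlow.
    assert (Hy : Rabs d / 5 <= y).
    { unfold y. rewrite Hd, Rabs_mult, (Rabs_pos_eq (INR L)) by lra. nra. }
    destruct (B4 ltac:(lra)) as [B5 B6].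
    (* From [y >= |d| / 5] and [d^2 >= 1]; the constants 700 and 350 are 14 and 7 times this 50. *)
    assert (Hinv : / y ^ 2 <= 50 * / (1 + d ^ 2)).
    { pose proof (pow2_abs d) as Hd2. assert (1 <= d ^ 2) by nra.
      assert (Hy2 : (1 + d ^ 2) / 50 <= y ^ 2) by nra.
      replace (50 * / (1 + d ^ 2)) with (/ ((1 + d ^ 2) / 50)) by (field; lra).
      apply Rinv_le_contravar; lra. }
    unfold Rdiv in B5, B6 |- *. split; nra.
  - assert (Hinv : / 2 <= / (1 + d ^ 2)).
    { pose proof (pow2_abs d) as Hd2. pose proof (Rabs_pos d). apply Rinv_le_contravar; nra. }
    split; [nra|].
    replace (al - 1 + Ci * 0)%C with (al - 1)%C by ring. nra.
Qed.

Lemma stage_rotation (eps tau : R) (J : nat) :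
  0 < eps -> / 8 < tau <= / 4 -> 4 * exp (120 / eps ^ 2) <= INR J ->
  exists n, (n <= J)%nat /\
    (forall j, (j < n)%nat -> 0 <= rot eps (4 * J) j tau) /\
    1 <= rsum (fun j => rot eps (4 * J) j tau) n.
Proof.
  intros He Htau HJ.
  assert (He2 : 0 < eps ^ 2) by (apply pow_lt; auto).
  assert (Hexp : 1 <= exp (120 / eps ^ 2)).
  { pose proof (exp_ineq1_le (120 / eps ^ 2)).
    assert (0 < 120 / eps ^ 2) by (apply Rdiv_lt_0_compat; lra). lra. }
  assert (HJ1 : (1 <= J)%nat) by (apply INR_le; simpl; lra).
  assert (HL : INR (4 * J) = 4 * INR J) by (rewrite mult_INR; simpl; ring).
  set (L := (4 * J)%nat) in *. set (t := INR L * tau).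
  assert (Ht : INR J / 2 <= t <= INR J) by (unfold t; nra).
  (* Stop just before resonance, since later blocks would turn the orbit back. For [j < n] the
     distance [t - j] is at least 1, so the cutoff in [rot] is inactive. *)
  destruct (nfloor_ex t ltac:(lra)) as [n [Hn1 Hn2]].
  assert (HA : forall j, (j < n)%nat -> eps ^ 2 / 120 * / (t - INR j) <= rot eps L j tau).
  { intros j Hj. assert (Hj' : INR j + 1 <= INR n) by (rewrite <- S_INR; apply le_INR; lia).
    pose proof (pos_INR j).
    unfold rot. fold t. destruct (Rle_dec 1 (Rabs (t - INR j))) as [_|H1].
    - assert (E : t - INR j = INR L * (tau - INR j / INR L)) by (unfold t; field; lra).
      assert (0 <= INR j / INR L) by (apply Rmult_le_pos; [lra|left; apply Rinv_0_lt_compat; lra]).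
      rewrite E. apply area_lower; [unfold L; lia|]. split; [nra|lra].
    - exfalso. apply H1. rewrite Rabs_pos_eq; lra. }
  exists n. split; [apply INR_le; lra|]. split.
  - intros j Hj. eapply Rle_trans; [|apply HA; auto].
    assert (INR j + 1 <= INR n) by (rewrite <- S_INR; apply le_INR; lia).
    apply Rmult_le_pos; [lra|left; apply Rinv_0_lt_compat; lra].
  - eapply Rle_trans; [|apply rsum_le, HA]. rewrite rsum_scal.
    pose proof (rsum_harmonic_ge_ln t n Hn1) as Hh.
    assert (Hln1 : ln (t - INR n + 1) <= ln 2) by (apply ln_le; lra).
    (* Of the factor 4 in the hypothesis, one 2 is lost in [t >= J / 2] and the other pays for the
       [ln 2] of the lower end. *)
    assert (Hln2 : ln 2 + 120 / eps ^ 2 <= ln (t + 1)).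
    { rewrite <- (ln_exp (120 / eps ^ 2)), <- ln_mult by (try apply exp_pos; lra).
      apply ln_le; [|lra]. apply Rmult_lt_0_compat; [lra|apply exp_pos]. }
    apply Rle_trans with (eps ^ 2 / 120 * (120 / eps ^ 2)); [right; field; lra|].
    apply Rmult_le_compat_l; lra.
Qed.

(** * The truncated transform as an orbit *)

Definition mat2_act (A : mat2) (v : C * C) : C * C :=
  ((m11 A * fst v + m12 A * snd v)%C, (m21 A * fst v + m22 A * snd v)%C).

Definition first_col (A : mat2) : C * C := (m11 A, m21 A).

Lemma first_col_mul (A B : mat2) : first_col (mat2_mul A B) = mat2_act A (first_col B).
Proof. reflexivity. Qed.

Lemma Cpow_nat_eq (z : C) (n : nat) : Cpow_nat z n = (z ^ n)%C.
Proof. induction n as [|n IH]; simpl; [reflexivity|now rewrite IH]. Qed.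

Lemma Cpow_Z_of_nat (z : C) (n : nat) : Cpow_Z z (Z.of_nat n) = (z ^ n)%C.
Proof.
  destruct n as [|n]; [reflexivity|]. simpl Z.of_nat. unfold Cpow_Z.
  now rewrite SuccNat2Pos.id_succ, Cpow_nat_eq.
Qed.

Lemma Cpow_Z_opp_of_nat (z : C) (n : nat) :
  Cmod z = 1 -> Cpow_Z z (- Z.of_nat n) = Cconj (z ^ n)%C.
Proof.
  intros Hz. destruct n as [|n].
  - simpl. unfold Cconj, RtoC; simpl; f_equal; ring.
  - simpl Z.of_nat. simpl Z.opp. unfold Cpow_Z.
    rewrite SuccNat2Pos.id_succ, Cpow_nat_eq, Cpow_conj. f_equal.
    assert (Hz0 : z <> 0) by (intros E; rewrite E, Cmod_0 in Hz; lra).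
    rewrite <- (Cmult_1_r (/ z)), <- (unit_mul_conj z Hz). field. exact Hz0.
Qed.

Lemma su11_factor_zero (G : Z -> C) (z : C) (n : Z) (v : C * C) :
  G n = 0 -> mat2_act (su11_factor G z n) v = v.
Proof.
  intros HG. unfold mat2_act, su11_factor; cbv [m11 m12 m21 m22].
  rewrite HG, Cmod_0. replace (1 - 0 ^ 2) with 1 by ring. rewrite sqrt_1, Rinv_1.
  replace (Cconj 0) with (RtoC 0) by (unfold Cconj, RtoC; simpl; f_equal; ring).
  destruct v as [a b]; simpl. f_equal; ring.
Qed.

Lemma su11_factor_orbit (G : Z -> C) (z : C) (g : nat -> C) (v : C * C) (n : nat) :
  Cmod z = 1 -> g n = (G (Z.of_nat n) * z ^ n)%C ->
  mat2_act (su11_factor G z (Z.of_nat n)) (orbit g v n) = orbit g v (S n).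
Proof.
  intros Hz Hg. rewrite orbit_S. unfold mat2_act, su11_factor.
  cbv zeta; cbv [m11 m12 m21 m22].
  rewrite Cpow_Z_of_nat, Cpow_Z_opp_of_nat by auto.
  replace (Cmod (g n)) with (Cmod (G (Z.of_nat n)))
    by (rewrite Hg, Cmod_mult, Cmod_pow, Hz, pow1; ring).
  rewrite Hg, Cmult_conj. f_equal; ring.
Qed.

Lemma nlft_trunc_orbit (F : Z -> C) (z : C) (N : nat) :
  Cmod z = 1 -> (forall n, (n < 0)%Z -> F n = 0) ->
  (frak_a F N z, frak_b F N z) =
  orbit (fun n => F (Z.of_nat n) * z ^ n)%C (RtoC 1, RtoC 0) (S N).
Proof.
  intros Hz HF. unfold frak_a, frak_b, nlft_trunc.
  set (G := trunc F N). set (g := fun n => (F (Z.of_nat n) * z ^ n)%C).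
  set (lo := (- Z.of_nat N)%Z).
  change (first_col (nlft_window G z lo (2 * N)) = orbit g (RtoC 1, RtoC 0) (S N)).
  assert (HG0 : forall n, (n < 0)%Z -> G n = 0).
  { intros n Hn. unfold G, trunc. destruct (Z.leb _ _); auto. }
  assert (HG1 : forall n, (n <= N)%nat -> g n = (G (Z.of_nat n) * z ^ n)%C).
  { intros n Hn. unfold G, trunc, g.
    assert (E : Z.leb (Z.abs (Z.of_nat n)) (Z.of_nat N) = true) by (apply Z.leb_le; lia).
    now rewrite E. }
  (* Window index [k] is position [k - N]. For [k < N] the truncated differences [k - N] and
     [S k - N] are both 0, matching the identity factors at negative positions. *)
  assert (Hstep : forall k, (k <= 2 * N)%nat ->
    mat2_act (su11_factor G z (lo + Z.of_nat k)) (orbit g (RtoC 1, RtoC 0) (k - N))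
    = orbit g (RtoC 1, RtoC 0) (S k - N)).
  { intros k Hk. destruct (le_lt_dec N k) as [H|H].
    - replace (lo + Z.of_nat k)%Z with (Z.of_nat (k - N)) by (unfold lo; lia).
      rewrite su11_factor_orbit by (auto; apply HG1; lia). f_equal; lia.
    - rewrite su11_factor_zero by (apply HG0; unfold lo; lia). f_equal; lia. }
  assert (H : forall k, (k <= 2 * N)%nat ->
    first_col (nlft_window G z lo k) = orbit g (RtoC 1, RtoC 0) (S k - N)).
  { induction k as [|k IH]; intros Hk.
    - rewrite <- (Hstep O) by lia. simpl nlft_window. rewrite Z.add_0_r.
      simpl orbit. unfold first_col, mat2_act; simpl fst; simpl snd. f_equal; ring.
    - cbn [nlft_window]. rewrite first_col_mul, IH by lia. apply Hstep; lia. }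
  rewrite H by lia. f_equal; lia.
Qed.

(** * The sequence *)

(** The off-diagonal entries of stage [k] add up to at most [8400 * stage_eps k]; the scale keeps
    the total over all stages below 1/32. *)
Definition stage_eps (k : nat) : R := / 1000000 * (/ 2) ^ k.

Definition stage_J (k : nat) : nat := S (Z.to_nat (up (4 * exp (120 / stage_eps k ^ 2)))).

Definition stage_L (k : nat) : nat := (4 * stage_J k)%nat.

(** Two levels of concatenation: [blk stage_J] splits a block number into stage and frequency,
    [blk block_len] a position into block and offset. *)
Definition block_len (q : nat) : nat := stage_L (fst (blk stage_J q)).

(* Block [j] of stage [k] carries the frequency [INR j / INR L - INR k / 8]: a
   stage covers an arc of length 1/4 and the arc drifts with [k], so that every
   point of the circle is visited infinitely often. *)
Definition block_coef (kj : nat * nat) (i : nat) : C :=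
  let (k, j) := kj in
  (RtoC (weight (stage_eps k) (stage_L k) i)
   * cis (INR k / 8 - INR j / INR (stage_L k)) ^ i)%C.

(* The isolated first coefficient keeps [frak_b] away from 0. *)
Definition coef (n : nat) : C :=
  match n with
  | O => RtoC (/ 2)
  | S m => let (q, i) := blk block_len m in block_coef (blk stage_J q) i
  end.

Definition coefZ (n : Z) : C :=
  match n with Zneg _ => RtoC 0 | _ => coef (Z.to_nat n) end.

Lemma stage_eps_pos (k : nat) : 0 < stage_eps k <= / 1000000.
Proof.
  unfold stage_eps. assert (0 < (/ 2) ^ k <= 1); [|lra].
  split; [apply pow_lt; lra|]. rewrite <- (pow1 k). apply pow_incr. lra.
Qed.

Lemma stage_J_pos (k : nat) : (0 < stage_J k)%nat.
Proof. unfold stage_J; lia. Qed.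

Lemma stage_J_large (k : nat) : 4 * exp (120 / stage_eps k ^ 2) <= INR (stage_J k).
Proof.
  unfold stage_J. set (r := 4 * exp (120 / stage_eps k ^ 2)).
  assert (Hr : 0 < r) by (unfold r; pose proof (exp_pos (120 / stage_eps k ^ 2)); lra).
  destruct (archimed r) as [H1 _]. rewrite S_INR, INR_IZR_INZ, Z2Nat.id; [lra|].
  apply le_IZR. lra.
Qed.

Lemma block_len_pos (q : nat) : (0 < block_len q)%nat.
Proof. unfold block_len, stage_L. pose proof (stage_J_pos (fst (blk stage_J q))). lia. Qed.

Lemma Cmod_block_coef (k j i : nat) : (i <= stage_L k)%nat ->
  Cmod (block_coef (k, j) i) = weight (stage_eps k) (stage_L k) i.
Proof.
  intros Hi. unfold block_coef. rewrite Cmod_mult, Cmod_pow, Cmod_cis, pow1, Cmod_R, Rmult_1_r.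
  apply Rabs_pos_eq. pose proof (stage_eps_pos k). pose proof (stage_J_pos k).
  apply weight_bounds; [lra|unfold stage_L; lia|auto].
Qed.

Lemma stage_L_ge_1 (k : nat) : 1 <= INR (stage_L k).
Proof. apply (le_INR 1). unfold stage_L. pose proof (stage_J_pos k). lia. Qed.

Lemma coef_lt_1 (n : nat) : Cmod (coef n) < 1.
Proof.
  destruct n as [|n]; simpl.
  - rewrite Cmod_R, Rabs_pos_eq; lra.
  - pose proof (blk_lt block_len block_len_pos n) as Hi.
    destruct (blk block_len n) as [q i]; simpl in Hi. unfold block_len in Hi.
    destruct (blk stage_J q) as [k j]; simpl fst in Hi.
    rewrite Cmod_block_coef by lia.
    pose proof (stage_eps_pos k). pose proof (stage_L_ge_1 k).
    assert (HL : (0 < stage_L k)%nat) by lia.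
    pose proof (weight_bounds (stage_eps k) (stage_L k) i ltac:(lra) HL ltac:(lia)) as [_ Hw].
    assert (stage_eps k / INR (stage_L k) <= stage_eps k); [|lra].
    apply Rmult_le_reg_r with (INR (stage_L k)); [lra|].
    unfold Rdiv. rewrite Rmult_assoc, Rinv_l by lra. nra.
Qed.

Lemma rsum_stage_eps (n : nat) (c : R) : 0 <= c ->
  rsum (fun k => c * stage_eps k) n <= c * (2 / 1000000).
Proof.
  intros Hc. rewrite rsum_scal. apply Rmult_le_compat_l; auto.
  unfold stage_eps. rewrite (rsum_scal (/ 1000000) (fun k => (/ 2) ^ k)).
  pose proof (rsum_geom_half n). lra.
Qed.

(** A block has energy at most [eps^2 / L], and stage [k] has [L / 4] blocks, hence energy at most
    [eps^2 / 4]; this is summable over the stages. *)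
Lemma coef_ell2 (n : nat) : rsum (fun m => Cmod (coef (S m)) ^ 2) n <= 1.
Proof.
  set (f := fun qi : nat * nat => let (q, i) := qi in Cmod (block_coef (blk stage_J q) i) ^ 2).
  rewrite (rsum_ext _ (fun m => f (blk block_len m)) n).
  2:{ intros m _. simpl coef. unfold f. now destruct (blk block_len m). }
  set (h := fun kj : nat * nat => let (k, _) := kj in stage_eps k ^ 2 / INR (stage_L k)).
  assert (Hh : forall p, 0 <= h p).
  { intros [k j]. unfold h. pose proof (stage_L_ge_1 k).
    apply Rmult_le_pos; [apply pow2_ge_0|left; apply Rinv_0_lt_compat; lra]. }
  apply (rsum_blk_le block_len block_len_pos f (fun q => h (blk stage_J q))).
  - intros [q i]. apply pow2_ge_0.
  - intros q. unfold f, h, block_len. destruct (blk stage_J q) as [k j]; simpl fst.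
    rewrite (rsum_ext _ (fun i => weight (stage_eps k) (stage_L k) i ^ 2)).
    2:{ intros i Hi. rewrite Cmod_block_coef by lia. reflexivity. }
    apply weight_energy. unfold stage_L. pose proof (stage_J_pos k). lia.
  - intros q0. apply (rsum_blk_le stage_J stage_J_pos h (fun k => 1 * stage_eps k)); auto.
    + intros k. unfold h. rewrite rsum_const. pose proof (stage_eps_pos k).
      pose proof (lt_0_INR _ (stage_J_pos k)).
      replace (INR (stage_L k)) with (4 * INR (stage_J k))
        by (unfold stage_L; rewrite mult_INR; simpl; ring).
      replace (INR (stage_J k) * (stage_eps k ^ 2 / (4 * INR (stage_J k))))
        with (stage_eps k ^ 2 / 4) by (field; lra). nra.
    + intros k. pose proof (rsum_stage_eps k 1). lra.
Qed.

Lemma arc_visited (z : C) (K : nat) : Cmod z = 1 ->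
  exists k, (K <= k)%nat /\ / 8 < carg (z * cis (INR k / 8))%C <= / 4.
Proof.
  intros Hz. set (t := carg z). pose proof (carg_bound z) as Ht. fold t in Ht.
  (* The condition [r < k <= r + 1] says that [t + k / 8 - 2 * p * PI] lies in [(1/8, 1/4]]: the
     target is as long as one drift step. Taking [p = K + 1] turns forces [k >= K]. *)
  set (p := S K). set (r := 1 + 16 * PI * INR p - 8 * t).
  assert (HPI : 3 < PI) by (pose proof PI2_3_2; lra).
  assert (Hp : INR p = INR K + 1) by (unfold p; apply S_INR).
  pose proof (pos_INR K).
  assert (Hr : INR K < r) by (unfold r; nra).
  destruct (archimed r) as [H1 H2].
  assert (Hk : INR (Z.to_nat (up r)) = IZR (up r)).
  { rewrite INR_IZR_INZ, Z2Nat.id; auto. apply le_IZR. lra. }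
  rewrite <- Hk in H1, H2.
  exists (Z.to_nat (up r)). set (k := Z.to_nat (up r)) in *. clearbody k.
  split; [apply INR_le; lra|].
  rewrite <- (cis_carg z Hz), <- cis_plus. fold t.
  set (s := t + INR k / 8 - 2 * INR p * PI).
  assert (Hs : / 8 < s <= / 4) by (unfold s; unfold r in H1, H2; lra).
  replace (t + INR k / 8) with (s + 2 * INR p * PI) by (unfold s; ring).
  rewrite cis_period_nat, carg_cis; lra.
Qed.

Lemma hat_nrm_ext (g h : nat -> C) (n : nat) :
  (forall i, (i < n)%nat -> g i = h i) -> hat g n = hat h n /\ nrm g n = nrm h n.
Proof.
  induction n as [|n IH]; intros H; [split; reflexivity|].
  destruct (IH (fun i Hi => H i ltac:(lia))) as [H1 H2].
  split; [simpl hat|rewrite !nrm_S]; rewrite ?H1, ?H2, (H n) by lia; reflexivity.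
Qed.

Lemma coef_diverges (z : C) : Cmod z = 1 ->
  let v := orbit (fun n => coef n * z ^ n)%C (RtoC 1, RtoC 0) in
  forall l,
  ~ (forall eta, 0 < eta -> exists N, forall n, (N <= n)%nat -> Cmod (fst (v (S n)) - l)%C < eta) /\
  ~ (forall eta, 0 < eta -> exists N, forall n, (N <= n)%nat -> Cmod (snd (v (S n)) - l)%C < eta).
Proof.
  intros Hz v l.
  (* The position of [z] relative to the drifted arc of stage [k]: block [j] of that stage sees
     [x = cis (tau k - j / L)]. *)
  set (tau := fun k => carg (z * cis (INR k / 8))%C).
  assert (Htau : forall k, cis (tau k) = (z * cis (INR k / 8))%C).
  { intros k. apply cis_carg. rewrite Cmod_mult, Hz, Cmod_cis. ring. }
  set (bg := fun q => let (k, j) := blk stage_J q in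
    block_g (stage_eps k) (stage_L k) (z ^ S (start block_len q))%C
      (cis (tau k - INR j / INR (stage_L k)))).
  set (al := fun q => (RtoC (nrm (bg q) (block_len q)) * hat_a (bg q) (block_len q))%C).
  set (be := fun q => (RtoC (nrm (bg q) (block_len q)) * hat_b (bg q) (block_len q))%C).
  set (A := fun q => let (k, j) := blk stage_J q in rot (stage_eps k) (stage_L k) j (tau k)).
  set (fb := fun kj : nat * nat => let (k, j) := kj in
    700 * stage_eps k * decay (stage_L k) j (tau k)).
  set (fe := fun kj : nat * nat => let (k, j) := kj in
    350 * stage_eps k ^ 2 * decay (stage_L k) j (tau k) + 5 * stage_eps k ^ 2 / INR (stage_L k)).
  (* The orbit is sampled at block ends only, since divergence of a subsequence suffices; [S] skips
     the isolated first coefficient. *)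
  set (a := fun q => fst (v (S (start block_len q)))).
  set (b := fun q => snd (v (S (start block_len q)))).
  assert (Hdec : forall k j, 0 < decay (stage_L k) j (tau k)).
  { intros k j. unfold decay. apply Rinv_0_lt_compat.
    pose proof (pow2_ge_0 (INR (stage_L k) * tau k - INR j)). lra. }
  assert (Hdecsum : forall k n, rsum (fun j => decay (stage_L k) j (tau k)) n <= 12).
  { intros k n. apply rsum_inv_quadratic. }
  assert (Hblock : forall q, Cmod (al q) ^ 2 = 1 + Cmod (be q) ^ 2 /\
    Cmod (be q) <= fb (blk stage_J q) /\
    Cmod (al q - 1 + Ci * RtoC (A q))%C <= fe (blk stage_J q)).
  { intros q. pose proof (blk_lt stage_J stage_J_pos q) as Hj.
    unfold al, be, A, fb, fe, bg, block_len.
    destruct (blk stage_J q) as [k j]; simpl fst in *; simpl snd in *.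
    pose proof (stage_eps_pos k).
    apply (stage_block (stage_eps k) (tau k) (stage_J k) j); auto; [lra|apply carg_bound|].
    now rewrite Cmod_pow, Hz, pow1. }
  assert (Hfbsum : forall k n, rsum (fun j => fb (k, j)) n <= 8400 * stage_eps k).
  { intros k n. unfold fb. rewrite rsum_scal. pose proof (stage_eps_pos k).
    specialize (Hdecsum k n). nra. }
  assert (Hab : forall q,
    a (S q) = (al q * a q + Cconj (be q) * b q)%C /\
    b (S q) = (be q * a q + Cconj (al q) * b q)%C).
  { intros q.
    set (h := fun i => (coef (S (start block_len q) + i) * z ^ (S (start block_len q) + i))%C).
    assert (Hext : forall i, (i < block_len q)%nat -> h i = bg q i).
    { intros i Hi. unfold h. simpl Nat.add. cbn [coef].
      rewrite (blk_start block_len block_len_pos q i Hi).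
      unfold bg, block_coef, block_g. destruct (blk stage_J q) as [k j].
      replace (cis (tau k - INR j / INR (stage_L k)))
        with (z * cis (INR k / 8 - INR j / INR (stage_L k)))%C.
      - change (S (start block_len q + i)) with (S (start block_len q) + i)%nat.
        rewrite Cpow_add_r, Cpow_mult_l. ring.
      - unfold Rminus. rewrite !cis_plus, Htau. ring. }
    destruct (hat_nrm_ext _ _ _ Hext) as [Hh Hn].
    pose proof (orbit_block (fun n => coef n * z ^ n)%C (RtoC 1, RtoC 0)
      (S (start block_len q)) (block_len q)) as Ho.
    cbv beta zeta in Ho. fold h in Ho. fold v in Ho.
    unfold hat_a, hat_b in Ho. rewrite Hh, Hn in Ho.
    unfold a, b. cbn [start].
    change (S (start block_len q + block_len q)) with (S (start block_len q) + block_len q)%nat.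
    rewrite Ho. split; reflexivity. }
  assert (Hs : 0 < sqrt (3 / 4) /\ sqrt (3 / 4) ^ 2 = 3 / 4).
  { split; [apply sqrt_lt_R0; lra|apply pow2_sqrt; lra]. }
  (* The coefficient 1/2 gives the start [(2, 1) / sqrt 3]: both moduli are at least 1/2 and their
     sum is [sqrt 3 <= 2]. *)
  assert (Hv1 : a O = RtoC (/ sqrt (3 / 4)) /\ b O = RtoC (/ sqrt (3 / 4) * / 2)).
  { unfold a, b, v. cbn [start]. rewrite orbit_S. cbv zeta. simpl orbit. cbn [fst snd coef].
    replace (RtoC (/ 2) * z ^ 0)%C with (RtoC (/ 2)) by (simpl; ring).
    rewrite Cmod_R, Rabs_pos_eq by lra. replace (1 - (/ 2) ^ 2) with (3 / 4) by field.
    rewrite RtoC_mult. split; ring. }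
  assert (Hi : 1 <= / sqrt (3 / 4) <= 4 / 3).
  { destruct Hs as [Hs1 Hs2]. split.
    - rewrite <- Rinv_1 at 1. apply Rinv_le_contravar; nra.
    - replace (4 / 3) with (/ (3 / 4)) by field. apply Rinv_le_contravar; nra. }
  assert (Hmod0 : Cmod (a O) = / sqrt (3 / 4) /\ Cmod (b O) = / sqrt (3 / 4) * / 2).
  { destruct Hv1 as [-> ->]. rewrite !Cmod_R, !Rabs_pos_eq by lra. auto. }
  destruct (su11_orbit_diverges al be a b A (fun q => fe (blk stage_J q))) with (l := l)
    as [Da Db].
  - apply Hab.
  - apply Hab.
  - apply Hblock.
  - intros n. eapply Rle_trans; [apply rsum_le; intros i _; apply Hblock|].
    apply (rsum_blk_le stage_J stage_J_pos fb (fun k => 8400 * stage_eps k)).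
    + intros [k j]. unfold fb. pose proof (stage_eps_pos k). specialize (Hdec k j). nra.
    + intros k; apply Hfbsum.
    + intros k. pose proof (rsum_stage_eps k 8400). lra.
  - lra.
  - lra.
  - lra.
  - apply Hblock.
  - intros eta N Heta.
    destruct (pow_lt_1_zero (/ 2) ltac:(rewrite Rabs_pos_eq; lra) eta Heta) as [K HK].
    (* The stage must begin after block [N] and also satisfy [2^-k < eta], so that its total error,
       at most [12605 * stage_eps k], is below [eta]. *)
    destruct (arc_visited z (max N K) Hz) as (k & Hk & Harc). fold (tau k) in Harc.
    pose proof (stage_eps_pos k) as Hek.
    destruct (stage_rotation (stage_eps k) (tau k) (stage_J k) ltac:(lra) Harc (stage_J_large k))
      as (n & Hn & HA0 & HA1).
    assert (Hq : forall i, (i < n)%nat -> blk stage_J (start stage_J k + i) = (k, i)).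
    { intros i Hin. apply blk_start; [apply stage_J_pos|lia]. }
    exists (start stage_J k), n. split; [|split; [|split]].
    + pose proof (start_ge stage_J stage_J_pos k). lia.
    + intros i Hin. unfold A. rewrite Hq by auto. now apply HA0.
    + eapply Rle_trans; [exact HA1|]. right. apply rsum_ext. intros i Hin.
      unfold A. now rewrite Hq by auto.
    + apply Rle_trans with (rsum (fun i => fe (k, i) + fb (k, i)) n).
      { apply rsum_le. intros i Hin. rewrite Hq by auto.
        pose proof (proj1 (proj2 (Hblock (start stage_J k + i)%nat))) as H.
        rewrite Hq in H by auto. lra. }
      rewrite rsum_plus. specialize (Hfbsum k n). unfold fe.
      rewrite rsum_plus, rsum_scal, rsum_const. specialize (Hdecsum k n).
      assert (HnL : INR n * (5 * stage_eps k ^ 2 / INR (stage_L k)) <= 5 * stage_eps k ^ 2).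
      { pose proof (stage_L_ge_1 k) as HL1.
        assert (INR n <= INR (stage_L k)) by (apply le_INR; unfold stage_L; lia).
        apply Rmult_le_reg_r with (INR (stage_L k)); [lra|].
        replace (INR n * (5 * stage_eps k ^ 2 / INR (stage_L k)) * INR (stage_L k))
          with (INR n * (5 * stage_eps k ^ 2)) by (field; lra).
        pose proof (pow2_ge_0 (stage_eps k)). nra. }
      assert (He : stage_eps k <= / 1000000 * eta).
      { unfold stage_eps. specialize (HK k ltac:(lia)).
        pose proof (Rle_abs ((/ 2) ^ k)). lra. }
      assert (stage_eps k ^ 2 <= stage_eps k) by nra.
      pose proof (pow2_ge_0 (stage_eps k)). nra.
  - assert (Hsub : forall (p : C * C -> C),
      (forall eta, 0 < eta -> exists N, forall n, (N <= n)%nat -> Cmod (p (v (S n)) - l)%C < eta) ->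
      forall eta, 0 < eta -> exists N, forall q, (N <= q)%nat ->
        Cmod (p (v (S (start block_len q))) - l)%C < eta).
    { intros p H eta Heta. destruct (H eta Heta) as [N HN]. exists N. intros q Hq.
      apply HN. pose proof (start_ge block_len block_len_pos q). lia. }
    split; intros H; [apply Da|apply Db]; apply (Hsub _ H).
Qed.

Theorem theorem1p1 :
  exists F : Z -> C,
    (forall n : Z, Cmod (F n) < 1) /\
    ell2_Z F /\
    (forall z : C, Cmod z = 1 ->
       ~ seq_has_limit (fun N : nat => frak_a F N z) /\
       ~ seq_has_limit (fun N : nat => frak_b F N z)).
Proof.
  exists coefZ.
  assert (Hnat : forall n, coefZ (Z.of_nat n) = coef n).
  { intros [|n]; [reflexivity|]. unfold coefZ. simpl Z.of_nat.
    now rewrite <- (Nat2Z.id (S n)). }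
  assert (Hneg : forall n, (n < 0)%Z -> coefZ n = 0).
  { intros [|p|p] Hn; [lia|lia|reflexivity]. }
  split; [|split].
  - intros n. destruct (Z_lt_le_dec n 0) as [H|H].
    + rewrite Hneg, Cmod_0 by auto. lra.
    + rewrite <- (Z2Nat.id n H), Hnat. apply coef_lt_1.
  - assert (Hhead : forall f : nat -> R, (forall i, 0 <= f i) ->
      (forall n, rsum (fun m => f (S m)) n <= 1) -> ex_series f).
    { intros f Hf H. apply ex_series_of_rsum_bound with (f O + 1); auto.
      (* The term at index 0 is split off, as [coef_ell2] concerns the later coefficients. *)
      intros n. apply Rle_trans with (rsum f (1 + n)).
      - apply rsum_mono; auto; lia.
      - rewrite rsum_split. simpl. specialize (H n). simpl in H. lra. }
    split; apply Hhead; try (intros; apply pow2_ge_0).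
    + intros n. rewrite (rsum_ext _ (fun m => Cmod (coef (S m)) ^ 2) n).
      * apply coef_ell2.
      * intros i _. now rewrite Hnat.
    + intros n. rewrite (rsum_ext _ (fun _ => 0) n), rsum_const; [lra|].
      intros i _. rewrite Hneg, Cmod_0 by lia. ring.
  - intros z Hz.
    assert (E : forall N, (frak_a coefZ N z, frak_b coefZ N z) =
      orbit (fun n => coef n * z ^ n)%C (RtoC 1, RtoC 0) (S N)).
    { intros N. rewrite nlft_trunc_orbit by auto.
      assert (Ho : forall n, orbit (fun n => coefZ (Z.of_nat n) * z ^ n)%C (RtoC 1, RtoC 0) n =
        orbit (fun n => coef n * z ^ n)%C (RtoC 1, RtoC 0) n); [|apply Ho].
      induction n as [|n IH]; [reflexivity|]. now rewrite !orbit_S, IH, Hnat. }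
    split; intros [l Hl]; pose proof (seq_limit_Cmod _ _ Hl) as H;
      destruct (coef_diverges z Hz l) as [Da Db].
    + apply Da. intros eta Heta. destruct (H eta Heta) as [N HN]. exists N.
      intros n Hn. rewrite <- E. now apply HN.
    + apply Db. intros eta Heta. destruct (H eta Heta) as [N HN]. exists N.
      intros n Hn. rewrite <- E. now apply HN.
Qed.
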